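(* For all $n\ge 2$, the real projective space $\mathbb{RP}^n$ (regarded as a small cover over the $n$-simplex via its natural $\mathbb{Z}_2^n$-action) has an equilibrium triangulation with $2^n+n+1$ vertices.
   Context: $\mathbb{Z}_2^n$ is the additive group of the vector space $\mathbb{F}_2^n$; it acts on $\mathbb{R}^n$ by the standard action (the $i$-th generator changes the sign of the $i$-th coordinate). A small cover over a simple $n$-polytope $Q$ is a closed $n$-manifold $N$ with an effective locally standard $\mathbb{Z}_2^n$-action (locally modelled, up to an automorphism of $\mathbb{Z}_2^n$, on invariant open subsets of the standard action on $\mathbb{R}^n$) whose orbit space is (diffeomorphic as a manifold with corners to) $Q$; $\xi:N\to Q$ is the orbit map. The natural action of $\mathbb{Z}_2^n$ on $\mathbb{RP}^n$ is $(g_1,\dots,g_n)\cdot[x_0,x_1,\dots,x_n]=[x_0,(-1)^{g_1}x_1,\dots,(-1)^{g_n}x_n]$; it makes $\mathbb{RP}^n$ a small cover over the $n$-simplex. Cubical subdivision: choose a point $C_F$ in the relative interior of each nonempty face $F$ of $Q$, with $C_Q$ the center of mass of $Q$. For faces $F\subseteq G$ let $I_{F\subseteq G}$ be the union of the simplices with vertices $C_{H_0},\dots,C_{H_r}$ over chains of faces $F\subseteq H_0\subset\dots\subset H_r\subseteq G$; these combinatorial cubes form a cubical subdivision $C(Q)$ of $Q$, whose maximal cubes are $I_v=I_{v\subseteq Q}$, one for each vertex $v$ of $Q$. The equilibrium set of $N$ is the orbit $\xi^{-1}(C_Q)$ ($2^n$ points). A zone of influence of $N$ is a $\mathbb{Z}_2^n$-invariant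 closed subset of $N$ that contains the equilibrium set and is $\mathbb{Z}_2^n$-equivariantly homeomorphic (up to an automorphism of $\mathbb{Z}_2^n$) to a $\mathbb{Z}_2^n$-invariant closed ball in $\mathbb{R}^n$. A collection $\{Z_1,\dots,Z_k\}$ of zones of influence is complete if the sets $\xi(Z_{i_1})\cap\dots\cap\xi(Z_{i_l})$ give a cubical subdivision of $Q$ (for example $\{\xi^{-1}(I_v) : v \text{ a vertex of } Q\}$ is complete). A triangulation of $N$ is a finite simplicial complex $X$ with a homeomorphism $|X|\cong N$. It is an equilibrium triangulation if the equilibrium set and all the zones of influence of some complete collection are triangulated submanifolds of $N$, i.e. carriers of subcomplexes of $X$. *)

(* Defs.v *)
From HB Require Import structures.
From mathcomp Require Import all_boot all_order all_algebra.
From mathcomp Require Import all_classical all_reals all_analysis.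
Set Implicit Arguments.
Unset Strict Implicit.
Unset Printing Implicit Defensive.
Import Order.TTheory GRing.Theory Num.Theory.
Import numFieldNormedType.Exports.
Local Open Scope classical_set_scope.
Local Open Scope ring_scope.
Local Open Scope quotient_scope.

Definition homeomorphism_between (S T : topologicalType)
    (A : set S) (B : set T) (f : S -> T) : Prop :=
  exists g : T -> S,
    [/\ {within A, continuous f} /\ {within B, continuous g},
        f @` A `<=` B, g @` B `<=` A,
        {in A, cancel f g} & {in B, cancel g f}].

(* The group Z_2^n is the additive group of 'rV['F_2]_n. *)
Definition sign_act (R : realType) (n : nat) (g : 'rV['F_2]_n) (x : 'rV[R]_n)
    : 'rV[R]_n :=
  \row_i ((-1) ^+ (g 0 i) * x 0 i).

Definition invariant (n : nat) (N : Type) (act : 'rV['F_2]_n -> N -> N)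
    (A : set N) : Prop :=
  forall g x, A x -> A (act g x).

(* The norm of 'rV[R]_n is the sup norm, hence the explicit sum of squares. *)
Definition euclidean_closed_ball (R : realType) (n : nat) (c : 'rV[R]_n)
    (r : R) : set 'rV[R]_n :=
  [set x | \sum_i (x 0 i - c 0 i) ^+ 2 <= r ^+ 2].

Definition polytope_face (R : realType) (m : nat) (Q F : set 'rV[R]_m) : Prop :=
  F !=set0 /\
  exists a : 'rV[R]_m,
    F = [set x | Q x /\ forall y, Q y ->
                   \sum_i a 0 i * y 0 i <= \sum_i a 0 i * x 0 i].

(* s i = Some b fixes the i-th coordinate to b, s i = None leaves it free; in
   particular unit_cube_face R (fun=> None) is the whole cube [0,1]^d, and the
   sets of this form are exactly its nonempty faces. *)
Definition unit_cube_face (R : realType) (d : nat) (s : 'I_d -> option bool)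
    : set 'rV[R]_d :=
  [set x | forall i, if s i is Some b then x 0 i = b%:R
                     else 0 <= x 0 i <= 1].
Arguments unit_cube_face R {d} s.

Definition unit_cube (R : realType) (d : nat) : set 'rV[R]_d :=
  unit_cube_face R (fun=> None).

(* C is the set of all cubes (of all dimensions) of the subdivision. The faces
   of a cube c are required to be exactly the members of C contained in c, so
   the third clause says that two cubes which meet do so in a common face. *)
Definition cubical_subdivision (R : realType) (m : nat) (Q : set 'rV[R]_m)
    (C : set (set 'rV[R]_m)) : Prop :=
  [/\ finite_set C,
      forall c, C c ->
        exists (d : nat) (f : 'rV[R]_d -> 'rV[R]_m),
          homeomorphism_between (@unit_cube R d) c f /\
          forall c', (C c' /\ c' `<=` c) <->
                     exists s, c' = f @` unit_cube_face R s,
      forall c c', C c -> C c' -> c `&` c' !=set0 -> C (c `&` c'),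
      \bigcup_(c in C) c = Q &
      forall F, polytope_face Q F ->
        F = \bigcup_(c in [set c | C c /\ c `<=` F]) c].

Definition maximal_cube (T : Type) (C : set (set T)) (c : set T) : Prop :=
  C c /\ forall c', C c' -> c `<=` c' -> c' = c.

(* Below, act is an action of Z_2^n on N with orbit map xi onto the polytope Q,
   and cQ is the center of mass of Q. *)

Definition equilibrium_set (R : realType) (m : nat) (N : Type)
    (xi : N -> 'rV[R]_m) (cQ : 'rV[R]_m) : set N :=
  xi @^-1` [set cQ].

Definition zone_of_influence (R : realType) (n m : nat) (N : topologicalType)
    (act : 'rV['F_2]_n -> N -> N) (xi : N -> 'rV[R]_m) (cQ : 'rV[R]_m)
    (Z : set N) : Prop :=
  [/\ closed Z, invariant act Z, equilibrium_set xi cQ `<=` Z &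
      exists (c : 'rV[R]_n) (r : R) (f : N -> 'rV[R]_n)
             (alpha : {additive 'rV['F_2]_n -> 'rV['F_2]_n}),
        [/\ 0 < r, invariant (@sign_act R n) (euclidean_closed_ball c r),
            homeomorphism_between Z (euclidean_closed_ball c r) f,
            bijective alpha &
            forall g x, Z x -> f (act g x) = sign_act (alpha g) (f x)]].

(* The intersections of the xi(Z_i) alone never include the cubes lying in
   the boundary of Q (for Z_v = xi^-1(I_v) they are the cubes I_{F <= Q}), so
   they "give" a subdivision in the sense that they are cubes of it and the
   xi(Z_i) are its maximal cubes. *)
Definition complete_zones (R : realType) (n m : nat) (N : topologicalType)
    (act : 'rV['F_2]_n -> N -> N) (Q : set 'rV[R]_m) (xi : N -> 'rV[R]_m)
    (cQ : 'rV[R]_m) (k : nat) (Z : 'I_k -> set N) : Prop :=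
  (forall i, zone_of_influence act xi cQ (Z i)) /\
  exists C : set (set 'rV[R]_m),
    [/\ cubical_subdivision Q C,
        forall J : {set 'I_k}, J != finset.set0 ->
          C (\bigcap_(j in [set` J]) (xi @` Z j)) &
        forall c, maximal_cube C c <-> exists i, c = xi @` Z i].

Definition simplicial_complex (m : nat) (X : {set {set 'I_m}}) : Prop :=
  forall s, s \in X ->
    s != finset.set0 /\
    forall t : {set 'I_m}, t \subset s -> t != finset.set0 -> t \in X.

Definition vertices (m : nat) (X : {set {set 'I_m}}) : {set 'I_m} :=
  [set v : 'I_m | finset.set1 v \in X]%SET.

Definition realization (R : realType) (m : nat) (X : {set {set 'I_m}})
    : set 'rV[R]_m :=
  [set t | [/\ forall i, 0 <= t 0 i, \sum_i t 0 i = 1 &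
               [set i | t 0%R i != 0%R]%SET \in X]].
Arguments realization R {m} X.

Definition triangulation (R : realType) (N : topologicalType) (m : nat)
    (X : {set {set 'I_m}}) (h : 'rV[R]_m -> N) : Prop :=
  simplicial_complex X /\ homeomorphism_between (realization R X) [set: N] h.

Definition triangulated (R : realType) (N : Type) (m : nat)
    (X : {set {set 'I_m}}) (h : 'rV[R]_m -> N) (A : set N) : Prop :=
  exists Y : {set {set 'I_m}},
    [/\ simplicial_complex Y, Y \subset X & h @` realization R Y = A].

Definition equilibrium_triangulation (R : realType) (n m : nat)
    (N : topologicalType) (act : 'rV['F_2]_n -> N -> N) (Q : set 'rV[R]_m)
    (xi : N -> 'rV[R]_m) (cQ : 'rV[R]_m)
    (p : nat) (X : {set {set 'I_p}}) (h : 'rV[R]_p -> N) : Prop :=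
  [/\ triangulation X h,
      triangulated X h (equilibrium_set xi cQ) &
      exists (k : nat) (Z : 'I_k -> set N),
        complete_zones act Q xi cQ Z /\
        forall i, triangulated X h (Z i)].

Definition std_simplex (R : realType) (n : nat) : set 'rV[R]_n.+1 :=
  [set t | (forall i, 0 <= t 0 i) /\ \sum_i t 0 i = 1].

Definition simplex_center (R : realType) (n : nat) : 'rV[R]_n.+1 :=
  const_mx n.+1%:R^-1.

Definition nonzero_vectors (R : realType) (n : nat) : set 'rV[R]_n :=
  [set x | x != 0].

Definition punctured (R : realType) (n : nat) : topologicalType :=
  set_type (@nonzero_vectors R n).

Definition proportional (R : realType) (n : nat) (x y : punctured R n) : bool :=
  `[< exists2 c : R, c != 0 & val y = c *: val x >].

Lemma proportional_refl (R : realType) (n : nat) :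
  reflexive (@proportional R n).
Proof. by move=> x; apply/asboolP; exists 1; rewrite ?oner_neq0 ?scale1r. Qed.

Lemma proportional_sym (R : realType) (n : nat) :
  symmetric (@proportional R n).
Proof.
suff h x y : @proportional R n x y -> proportional y x.
  by move=> x y; apply/idP/idP; exact: h.
move=> /asboolP[c c0 xy]; apply/asboolP; exists c^-1; first by rewrite invr_eq0.
by rewrite xy scalerA mulVf// scale1r.
Qed.

Lemma proportional_trans (R : realType) (n : nat) :
  transitive (@proportional R n).
Proof.
move=> y x z /asboolP[c c0 xy] /asboolP[d d0 yz]; apply/asboolP.
by exists (d * c); rewrite ?mulf_neq0// yz xy scalerA.
Qed.

Canonical proportional_equiv (R : realType) (n : nat) :=
  EquivRel (@proportional R n) (@proportional_refl R n)
    (@proportional_sym R n) (@proportional_trans R n).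

Definition RP (R : realType) (n : nat) : topologicalType :=
  quotient_topology {eq_quot (@proportional_equiv R n.+1)}.

Definition lift_sign_act (R : realType) (n : nat) (g : 'rV['F_2]_n)
    (x : 'rV[R]_n.+1) : 'rV[R]_n.+1 :=
  row_mx (lsubmx (x : 'rV_(1 + n))) (sign_act g (rsubmx (x : 'rV_(1 + n)))).

Lemma lift_sign_actE (R : realType) (n : nat) (g : 'rV['F_2]_n)
    (x : 'rV[R]_n.+1) (i : 'I_n.+1) :
  lift_sign_act g x 0 i =
    (if unlift ord0 i is Some j then (-1) ^+ (g 0 j) else 1) * x 0 i.
Proof.
rewrite /lift_sign_act; case: unliftP => [j|] ->.
  have -> : lift ord0 j = rshift 1 j by apply: val_inj.
  by rewrite [LHS](@row_mxEr _ 1 1 n) !mxE.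
have -> : ord0 = lshift n (ord0 : 'I_1) by apply: val_inj.
by rewrite [LHS](@row_mxEl _ 1 1 n) mxE mul1r.
Qed.

Lemma lift_sign_actZ (R : realType) (n : nat) (g : 'rV['F_2]_n) (c : R)
    (x : 'rV[R]_n.+1) :
  lift_sign_act g (c *: x) = c *: lift_sign_act g x.
Proof.
by apply/rowP => i; rewrite lift_sign_actE [RHS]mxE lift_sign_actE mxE mulrCA.
Qed.

Lemma lift_sign_act_neq0 (R : realType) (n : nat) (g : 'rV['F_2]_n)
    (x : punctured R n.+1) :
  lift_sign_act g (val x) \in @nonzero_vectors R n.+1.
Proof.
have /= x0 := set_valP x; apply/mem_set => /=.
apply: contra x0 => /eqP gx0; apply/eqP/rowP => i; rewrite mxE; apply/eqP.
move/rowP/(_ i)/eqP: gx0; rewrite lift_sign_actE mxE mulf_eq0.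
by case: unliftP => [j|] _; rewrite ?signr_eq0 ?oner_eq0.
Qed.

Definition punctured_act (R : realType) (n : nat) (g : 'rV['F_2]_n)
    (x : punctured R n.+1) : punctured R n.+1 :=
  SigSub (lift_sign_act_neq0 g x).

Definition RP_act (R : realType) (n : nat) (g : 'rV['F_2]_n) (p : RP R n)
    : RP R n :=
  \pi_(RP R n) (punctured_act g (repr p)).

Definition orbit_coordinates (R : realType) (n : nat) (x : 'rV[R]_n)
    : 'rV[R]_n :=
  \row_i (x 0 i ^+ 2 / \sum_j x 0 j ^+ 2).

Definition RP_orbit_map (R : realType) (n : nat) (p : RP R n) : 'rV[R]_n.+1 :=
  orbit_coordinates (val (repr p)).

Lemma RP_piP (R : realType) (n : nat) (x y : punctured R n.+1) :
  \pi_(RP R n) x = \pi_(RP R n) y <->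
  exists2 c : R, c != 0 & val y = c *: val x.
Proof.
by split=> [/eqmodP/asboolP//|xy]; apply/eqmodP/asboolP.
Qed.

Lemma RP_act_pi (R : realType) (n : nat) (g : 'rV['F_2]_n)
    (x : punctured R n.+1) :
  RP_act g (\pi_(RP R n) x) = \pi_(RP R n) (punctured_act g x).
Proof.
have /RP_piP[c c0 xE] : \pi_(RP R n) (repr (\pi_(RP R n) x)) = \pi_(RP R n) x.
  by rewrite reprK.
by apply/RP_piP; exists c => //; rewrite /= xE lift_sign_actZ.
Qed.

Lemma RP_orbit_map_pi (R : realType) (n : nat) (x : punctured R n.+1) :
  RP_orbit_map (\pi_(RP R n) x) = orbit_coordinates (val x).
Proof.
have /RP_piP[c c0 xE] : \pi_(RP R n) (repr (\pi_(RP R n) x)) = \pi_(RP R n) x.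
  by rewrite reprK.
apply/rowP => i; rewrite !mxE xE mxE.
under [in RHS]eq_bigr do rewrite mxE exprMn.
rewrite -mulr_sumr exprMn invfM mulrACA divff ?mul1r//.
by rewrite expf_neq0.
Qed.

Lemma sum_sqr_gt0 (R : realType) (n : nat) (x : 'rV[R]_n) :
  x != 0 -> 0 < \sum_j x 0 j ^+ 2.
Proof.
move=> x0; rewrite lt_def sumr_ge0 ?andbT => [|i _]; last exact: sqr_ge0.
apply: contra x0; rewrite psumr_eq0 => [|i _]; last exact: sqr_ge0.
move=> /allP xs; apply/eqP/rowP => i; rewrite mxE; apply/eqP.
by move: (xs i); rewrite mem_index_enum sqrf_eq0 => /(_ isT).
Qed.

Lemma RP_orbit_map_image (R : realType) (n : nat) :
  range (@RP_orbit_map R n) = @std_simplex R n.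
Proof.
apply/seteqP; split=> [_ [p _ <-]|t [t0 t1]].
  have /= x0 := set_valP (repr p).
  split=> [i|]; rewrite /RP_orbit_map.
    rewrite mxE divr_ge0 ?sqr_ge0//.
    by apply: ltW; exact: sum_sqr_gt0.
  under eq_bigr do rewrite mxE.
  by rewrite -mulr_suml divff// gt_eqF// sum_sqr_gt0.
pose x : 'rV[R]_n.+1 := \row_i Num.sqrt (t 0 i).
have xE i : x 0 i ^+ 2 = t 0 i by rewrite mxE sqr_sqrtr.
have x0 : x \in @nonzero_vectors R n.+1.
  apply/mem_set => /=; apply/eqP => x0.
  move/eqP: t1; rewrite big1 => [|i _]; first by rewrite eq_sym oner_eq0.
  by rewrite -xE x0 mxE expr0n.
exists (\pi_(RP R n) (SigSub x0 : punctured R n.+1)) => //.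
rewrite RP_orbit_map_pi; apply/rowP => i; rewrite mxE /= xE.
by under eq_bigr do rewrite xE; rewrite t1 divr1.
Qed.

Lemma RP_orbit_map_fiber (R : realType) (n : nat) (p q : RP R n) :
  RP_orbit_map p = RP_orbit_map q <-> exists g, q = RP_act g p.
Proof.
rewrite -[p]reprK -[q]reprK; move: (repr p) (repr q) => x y.
rewrite !RP_orbit_map_pi; split=> [xy|[g]]; last first.
  rewrite RP_act_pi => /RP_piP[c c0 /= gE].
  have sE i : val y 0 i ^+ 2 = (c ^+ 2)^-1 * val x 0 i ^+ 2.
    have := congr1 (fun z : 'rV[R]_n.+1 => z 0 i ^+ 2) gE.
    rewrite lift_sign_actE mxE !exprMn.
    case: unliftP => [j|] _; rewrite ?sqrr_sign ?expr1n mul1r => ->;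
      by rewrite mulKf// expf_neq0.
  have : (c ^+ 2)^-1 != 0 by rewrite invr_neq0// expf_neq0.
  move: (_^-1) sE => k sE k0; apply/rowP => i; rewrite !mxE sE.
  under [in RHS]eq_bigr do rewrite sE.
  by rewrite -mulr_sumr invfM mulrACA divff ?mul1r.
have x0 := sum_sqr_gt0 (set_valP x).
have y0 := sum_sqr_gt0 (set_valP y).
set u := val x in xy x0 *; set v := val y in xy y0 *.
set su := \sum_j _ in x0; set sv := \sum_j _ in y0.
pose r := Num.sqrt (sv / su).
have r0 : 0 < r by rewrite sqrtr_gt0 divr_gt0.
have vE i : v 0 i = r * u 0 i \/ v 0 i = - (r * u 0 i).
  have : v 0 i ^+ 2 == (r * u 0 i) ^+ 2.
    rewrite exprMn sqr_sqrtr; last by rewrite ltW// divr_gt0.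
    move/rowP/(_ i): xy; rewrite !mxE -/su -/sv => xy.
    by rewrite mulrAC -mulrA xy [sv * _]mulrC divfK// (gt_eqF y0).
  by rewrite eqf_sqr => /orP[]/eqP; [left|right].
pose e : R := if v 0 ord0 == r * u 0 ord0 then r else - r.
have e0 : e != 0 by rewrite /e; case: ifP; rewrite ?oppr_eq0 (gt_eqF r0).
have veE i : v 0 i = e * u 0 i \/ v 0 i = - (e * u 0 i).
  by rewrite /e; case: ifP => _; rewrite ?mulNr ?opprK; case: (vE i); tauto.
have ve0 : v 0 ord0 = e * u 0 ord0.
  rewrite /e; case: eqP => // h; rewrite mulNr.
  by case: (vE ord0).
exists (\row_j (v 0 (lift ord0 j) != e * u 0 (lift ord0 j))%:R).
rewrite RP_act_pi; apply/esym/RP_piP; exists e => //=.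
apply/rowP => i; rewrite mxE lift_sign_actE -/u -/v.
case: unliftP => [j|] ->; last by rewrite mul1r.
rewrite mxE; case: eqP => h; first by rewrite expr0 mul1r.
rewrite expr1 mulN1r mulrN.
by case: (veE (lift ord0 j)).
Qed.

(* Main.v *)
From HB Require Import structures.
Require Import Defs.
From mathcomp Require Import all_boot all_order all_algebra.
From mathcomp Require Import ring lra.

(** View RP^n as the boundary of the cube [-1,1]^m, m = n + 1, modulo x ~ -x.
The equilibrium set consists of the 2^n classes of cube vertices, and the zones
are the n + 1 pairs of opposite facets.  The order (Kuhn) triangulation of the
facets, whose simplices are chains of vertices, is antipodal and uses no further
vertices, but its quotient is not a simplicial complex: a class {C, ~C} with
2 <= |C| <= m - 2 is joined to the class of the corner -1 = [set0] by two
different edges.  This is the only defect, because for C and D other than the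
empty and the full set at most one of the pairs (C, D), (C, ~D) is comparable.

Hence one truncates the corner -1 (and antipodally the corner 1).  The n + 1
additional vertices are the midpoints z_i of the edges at that corner;
  the corner
is cut off by the simplices {set0} + {z_i | i in T}, and the remaining cells
are triangulated by {z_i | i in T} + {C_1 < ... < C_k} with T contained in C_1.
Then z_i is joined only to the member of {C, ~C} that contains i.  Putting the
additional vertices at the centers of the zones instead would not remove the
double edges.

With y = (1 + x) / 2 >= 0, min y = 0, a point is written uniquely as
y = mu / 2 + \sum_C l_C 1_C: the level L = \sum_(C nonempty) l_C is
  characterized
by \sum_i (y_i - L)^+ = (1 - L) / 2 (unless y lies in the cut-off corner, where
L = 0), mu_i / 2 = (y_i - L)^+, and l is the layer decomposition of min (y,
  L). *)

Set Implicit Arguments.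
Unset Strict Implicit.
Unset Printing Implicit Defensive.
Import Order.TTheory GRing.Theory Num.Theory.
Local Open Scope ring_scope.

(** * Chains of sets and layered sums *)

Definition chain_supported (R : realFieldType) (I : finType)
    (l : {set I} -> R) :=
  (forall C, 0 <= l C) /\
  (forall C D, l C != 0 -> l D != 0 -> (C \subset D) || (D \subset C)).

Definition layer_sum (R : realFieldType) (I : finType) (l : {set I} -> R)
    (k : I) : R :=
  \sum_(C : {set I} | k \in C) l C.

Lemma sum_subpred (R : realFieldType) (J : finType) (P Q : pred J)
    (f : J -> R) :
  (forall j, 0 <= f j) -> (forall j, f j != 0 -> P j -> Q j) ->
  \sum_(j | P j) f j <= \sum_(j | Q j) f j.
Proof.
move=> f0 PQ; rewrite [leLHS]big_mkcond [leRHS]big_mkcond.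
apply: ler_sum => j _; case: ifPn => Pj; last by case: ifP.
by have [->|fj] := eqVneq (f j) 0; [case: ifP | rewrite (PQ j)].
Qed.

Lemma sum_eqpred (R : realFieldType) (J : finType) (P Q : pred J)
    (f : J -> R) :
  (forall j, 0 <= f j) -> (forall j, f j != 0 -> P j = Q j) ->
  \sum_(j | P j) f j = \sum_(j | Q j) f j.
Proof.
move=> f0 PQ; apply/le_anti/andP; split; apply: sum_subpred => // j fj.
  by rewrite PQ.
by rewrite -PQ.
Qed.

(** The supported sets form a chain, so the largest one not containing [C] includes all others of
    this kind. A point of [C] outside it lies in exactly those supported sets that contain [C]; if
    there is no such set, any point of [C] serves. *)
Lemma layer_sum_inside (R : realFieldType) (I : finType) (l : {set I} -> R)
    (C : {set I}) : chain_supported l -> C != set0 ->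
  exists2 k, k \in C & layer_sum l k = \sum_(D : {set I} | C \subset D) l D.
Proof.
move=> [l0 lch] /set0Pn[c cC].
case: (pickP (fun D : {set I} => (l D != 0) && ~~ (C \subset D))) =>
  [D0 PD0|noD].
  case: (@arg_maxnP _ D0 (fun D : {set I} => (l D != 0) && ~~ (C \subset D))
    (fun D : {set I} => #|D|) PD0) => E /andP[lE /subsetPn[k kC kE]] Emax.
  exists k => //; apply: sum_eqpred => // D lD;
    apply/idP/idP => [kD|/subsetP->//].
  apply: contraT => nCD; have /orP[DE|ED] := lch _ _ lD lE.
    by rewrite (subsetP DE) in kE.
  have /Emax : (l D != 0) && ~~ (C \subset D) by rewrite lD.
  move=> cDE; have /eqP EeD : E == D by rewrite eqEcard ED.
  by rewrite EeD kD in kE.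
exists c => //; apply: sum_eqpred => // D lD.
have := noD D; rewrite lD /= => /negbFE CD.
by rewrite CD (subsetP CD).
Qed.

(** Dually, a point outside [C] of the smallest supported set not contained in [C] lies in all
    supported sets not contained in [C]. *)
Lemma layer_sum_outside (R : realFieldType) (I : finType) (l : {set I} -> R)
    (C : {set I}) : chain_supported l -> C != setT ->
  exists2 k, k \notin C & layer_sum l k = \sum_(D : {set I} |
    ~~ (D \subset C)) l D.
Proof.
move=> [l0 lch] CT.
have [c cC] : exists c, c \notin C.
  by apply/existsP; apply: contraNT CT => /existsPn h; apply/eqP/setP => x;
    rewrite inE; have := h x; rewrite negbK.
case: (pickP (fun D : {set I} => (l D != 0) && ~~ (D \subset C))) =>
  [D0 PD0|noD].
  case: (@arg_minnP _ D0 (fun D : {set I} => (l D != 0) && ~~ (D \subset C))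
    (fun D : {set I} => #|D|) PD0) => E /andP[lE /subsetPn[k kE kC]] Emin.
  exists k => //; apply: sum_eqpred => // D lD; apply/idP/idP => [kD|nDC].
    by apply: contra kC => /subsetP->.
  have /orP[DE|/subsetP->//] := lch _ _ lD lE.
  have /Emin cED : (l D != 0) && ~~ (D \subset C) by rewrite lD.
  by have /eqP-> : D == E by rewrite eqEcard DE.
exists c => //; apply: sum_eqpred => // D lD.
have := noD D; rewrite lD /= => /negbFE DC.
by rewrite DC; apply: contraNF cC => /(subsetP DC).
Qed.

(** Consider the minimum of the layer sum on [C] minus its maximum off [C]. For chain-supported
    weights this gap is at most the weight of [C], with equality when [C] itself is supported, and
    it depends on the layer sum only. *)
Lemma layer_sum_inj_le (R : realFieldType) (I : finType) (l l' : {set I} -> R) :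
  chain_supported l -> chain_supported l' -> layer_sum l =1 layer_sum l' ->
  forall C, C != set0 -> C != setT -> l C != 0 -> l C <= l' C.
Proof.
move=> lc lc' ll' C C0 CT lC.
have inC (f : {set I} -> R) k : chain_supported f -> k \in C ->
    \sum_(D : {set I} | C \subset D) f D <= layer_sum f k.
  by move=> [f0 _] kC; apply: sum_subpred => // D _ /subsetP->.
have outC (f : {set I} -> R) k : chain_supported f -> k \notin C ->
    layer_sum f k <= \sum_(D : {set I} | ~~ (D \subset C)) f D.
  by move=> [f0 _] kC; apply: sum_subpred => // D _ kD;
    apply: contra kC => /subsetP->.
have U : \sum_(D : {set I} | C \subset D) l D <= \sum_(D : {set I} |
  C \subset D) l' D.
  by have [k kC <-] := layer_sum_inside lc' C0; rewrite -ll'; exact: inC.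
have B : \sum_(D : {set I} | ~~ (D \subset C)) l' D <= \sum_(D : {set I} |
  ~~ (D \subset C)) l D.
  by have [k kC <-] := layer_sum_outside lc' CT; rewrite -ll'; exact: outC.
have split1 (f : {set I} -> R) : \sum_(D : {set I} | C \subset D) f D =
    f C + \sum_(D : {set I} | (C \subset D) && (D != C)) f D.
  by rewrite (bigD1 C).
have sub1 (f : {set I} -> R) : chain_supported f ->
  \sum_(D : {set I} | (C \subset D) && (D != C)) f D <=
  \sum_(D : {set I} | ~~ (D \subset C)) f D.
  move=> [f0 _]; apply: sum_subpred => // D _ /andP[CD DC].
  by apply: contra DC => DC; rewrite eqEsubset DC.
have eq1 : \sum_(D : {set I} | (C \subset D) && (D != C)) l D =
  \sum_(D : {set I} | ~~ (D \subset C)) l D.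
  case: lc => l0 lch; apply: sum_eqpred => // D lD.
  rewrite eqEsubset; case: (boolP (C \subset D)) => CD /=;
    first by rewrite andbT.
  by have := lch _ _ lC lD; rewrite (negbTE CD) /= => ->.
rewrite !split1 in U; have := sub1 _ lc'; rewrite eq1 in U; lra.
Qed.

Lemma layer_sum_inj (R : realFieldType) (I : finType) (l l' : {set I} -> R) :
  chain_supported l -> chain_supported l' -> layer_sum l =1 layer_sum l' ->
  forall C, C != set0 -> C != setT -> l C = l' C.
Proof.
move=> lc lc' ll' C C0 CT; have ll'' k := esym (ll' k).
have h := layer_sum_inj_le lc lc' ll' C0 CT.
have h' := layer_sum_inj_le lc' lc ll'' C0 CT.
have [lC|lC] := eqVneq (l C) 0; have [l'C|l'C] := eqVneq (l' C) 0.
- by rewrite lC l'C.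
- by have := h' l'C; rewrite lC => le0; case: lc' => /(_ C) ? _;
    apply/esym/le_anti; rewrite le0.
- by have := h lC; rewrite l'C => le0; case: lc => /(_ C) ? _;
    apply/le_anti; rewrite le0.
- by apply/le_anti; rewrite h// h'.
Qed.

(** Induction on the size of the support of [w]: the least nonzero value [w a] is subtracted on the
    whole support [C0] and becomes the weight of [C0]. The last clause makes supported sets upward
    closed for [w], so any two of them are comparable. *)
Lemma layer_cake (R : realFieldType) (I : finType) (w : I -> R) :
  (forall k, 0 <= w k) ->
  exists l : {set I} -> R,
    [/\ forall C, 0 <= l C, l set0 = 0, layer_sum l =1 w &
        forall C j k, l C != 0 -> j \in C -> w j <= w k -> k \in C].
Proof.
have [N] := ubnP #|[set k | w k != 0]|; elim: N w => // N IH w wN w0.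
case: (pickP (fun k => w k != 0)) => [k0 wk0|w00]; last first.
  exists (fun=> 0); split => // [k|C j k]; last by rewrite eqxx.
  by rewrite /layer_sum big1//; have /negbFE/eqP := w00 k.
case: (@arg_minP _ _ _ k0 (fun k => w k != 0) w wk0) => a wa amin.
pose C0 := [set k | w k != 0].
pose w' k := w k - (if k \in C0 then w a else 0).
have w'0 k : 0 <= w' k.
  by rewrite /w' inE; case: ifP => wk; [rewrite subr_ge0 amin | rewrite subr0].
have w'C k : w' k != 0 -> w k != 0.
  by apply: contra_neq => wk; rewrite /w' inE wk eqxx subr0.
have w'N : (#|[set k | w' k != 0%R]| < N)%N.
  rewrite -ltnS; apply: leq_trans wN; rewrite ltnS; apply: proper_card.
  apply/properP; split.
    by apply/subsetP => k; rewrite !inE; exact: w'C.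
  by exists a; rewrite inE// /w' !inE wa subrr eqxx.
have [l [l0 lE lw lup]] := IH w' w'N w'0.
have C0n : C0 != set0 by apply/set0Pn; exists k0; rewrite inE.
have lC k C : l C != 0 -> k \in C -> w' k != 0.
  move=> lC kC; rewrite -lw; apply: contraNneq lC => s0; apply/eqP/le_anti.
  rewrite l0 andbT -s0 /layer_sum (bigD1 C)//= lerDl.
  by apply: sumr_ge0.
exists (fun C => l C + (if C == C0 then w a else 0)); split => [C||k|C j k].
- by rewrite addr_ge0//; case: ifP.
- by rewrite lE add0r ifN// eq_sym.
- rewrite /layer_sum big_split /= [X in X + _]lw /w' -big_mkcondr /=.
  have [kC|kC] := boolP (k \in C0).
    rewrite (bigD1 C0) ?kC ?eqxx//= big1 ?addr0 ?subrK// => D.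
    by rewrite -andbA => /and3P[_ /eqP-> /eqP].
  by rewrite subr0 big1 ?addr0// => D /andP[kD /eqP DC]; rewrite -DC kD in kC.
have [->|_] := eqVneq C C0; last first.
  rewrite addr0 => lnC jC jk; apply: (lup C j k) => //.
  have wj := w'C _ (lC _ _ lnC jC).
  have wk : w k != 0.
    by rewrite gt_eqF// (lt_le_trans _ jk)// lt_def wj w0.
  by rewrite /w' !inE wj wk lerB.
rewrite !inE => _ wj jk.
by rewrite gt_eqF// (lt_le_trans _ jk)// lt_def wj w0.
Qed.

(** * Flags of cube vertices and edge midpoints *)

(* Vertices of the triangulated sphere: [inl C] is the vertex [2 * 1_C - 1] of
   the cube [-1, 1]^m, and [inr i] the midpoint of the edge from the corner
   [-1] = [inl set0] in direction [i].  Only the part of the sphere on which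
   some coordinate is [-1] is covered by flags. *)
Definition lifted_vertex (m : nat) : finType := ({set 'I_m} + 'I_m)%type.

(** The antipodal map on corners. The antipode of a midpoint lies at the corner 1 and is not a
    lifted vertex, so [inr i] is fixed as a default value. *)
Definition vertex_opp (m : nat) (a : lifted_vertex m) : lifted_vertex m :=
  match a with inl C => inl (~: C) | inr i => inr i end.

(** The vertex lies on the facet where coordinate [j] is -1; the midpoint [inr i] has coordinate 0
    at [i] and -1 elsewhere. *)
Definition avoids (m : nat) (j : 'I_m) (a : lifted_vertex m) : bool :=
  match a with inl C => j \notin C | inr i => j != i end.

(** Adjacency after truncation. The condition on emptiness removes the Kuhn edges from [set0] to the
    other corners; midpoints take over, being joined to [set0], to each other, and to the corners
    beyond the cut that contain their index. *)
Definition compatible (m : nat) (a b : lifted_vertex m) : bool :=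
  match a, b with
  | inl C, inl D =>
      ((C \subset D) || (D \subset C)) && ((C == set0) == (D == set0))
  | inl C, inr i | inr i, inl C => (C == set0) || (i \in C)
  | inr _, inr _ => true
  end.

Definition compatible_set (m : nat) (S : {set lifted_vertex m}) : bool :=
  [forall a in S, forall b in S, compatible a b].

Definition flag_avoiding (m : nat) (j : 'I_m) (S : {set lifted_vertex m}) :=
  compatible_set S && [forall a in S, avoids j a].

Lemma compatible_setP (m : nat) (S : {set lifted_vertex m}) :
  reflect (forall a b, a \in S -> b \in S -> compatible a b) (compatible_set S).
Proof.
apply: (iffP forall_inP) => [h a b aS bS|h a aS].
  exact: (forall_inP (h a aS)).
by apply/forall_inP => b bS; exact: h.
Qed.

Lemma flag_avoidingP (m : nat) (j : 'I_m) (S : {set lifted_vertex m}) :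
  reflect ((forall a b, a \in S -> b \in S -> compatible a b) /\
           (forall a, a \in S -> avoids j a)) (flag_avoiding j S).
Proof.
apply: (iffP andP) => [[/compatible_setP h /forall_inP h']|[h h']] //.
by split; [exact/compatible_setP | exact/forall_inP].
Qed.

Lemma flag_avoidingS (m : nat) (j : 'I_m) (S T : {set lifted_vertex m}) :
  T \subset S -> flag_avoiding j S -> flag_avoiding j T.
Proof.
move=> /subsetP TS /flag_avoidingP[h h']; apply/flag_avoidingP.
by split => [a b /TS aS /TS bS|a /TS aS]; [exact: h | exact: h'].
Qed.

Definition vertex_class (n : nat) (a : lifted_vertex n.+1) :
    lifted_vertex n.+1 :=
  match a with
  | inl C => inl (if ord0 \in C then ~: C else C)
  | inr i => inr i
  end.

Lemma vertex_class_opp (n : nat) (a : lifted_vertex n.+1) :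
  vertex_class (vertex_opp a) = vertex_class a.
Proof. by case: a => //= C; rewrite inE; case: (ord0 \in C);
  rewrite //= setCK. Qed.

Lemma vertex_class_eq (n : nat) (a b : lifted_vertex n.+1) :
  vertex_class a = vertex_class b -> b = a \/ b = vertex_opp a.
Proof.
case: a b => [C|i] [D|j] //= [].
  case: (ord0 \in C); case: (ord0 \in D).
  - by move=> /setC_inj->; left.
  - by move=> <-; right.
  - by move=> ->; rewrite setCK; right.
  - by move=> ->; left.
by move=> ->; left.
Qed.

(** A common vertex fixes the lift. If [D] were in [S] and its complement in [T], a common midpoint
    would have its index in both sets, and a common corner would be comparable to both, which forces
    it to be [set0] or [setT]. Compatibility with the nonempty [D] excludes the former, avoidance
    the latter. *)
Lemma flag_lift_sub (n : nat) (i j : 'I_n.+1)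
    (S T : {set lifted_vertex n.+1}) (a : lifted_vertex n.+1) :
  flag_avoiding i S -> flag_avoiding j T ->
  @vertex_class n @: S = @vertex_class n @: T ->
  a \in S -> a \in T -> S \subset T.
Proof.
move=> /flag_avoidingP[cS aS] /flag_avoidingP[cT aT] ST Sa Ta.
apply/subsetP => b Sb.
have /imsetP[b' Tb'] : vertex_class b \in @vertex_class n @: T.
  by rewrite -ST imset_f.
move=> /vertex_class_eq[<-//|b'E].
case: b => [D|k] in Sb b'E *;
  last by rewrite -[inr k]/(vertex_opp (inr k)) -b'E.
have {b'E}TD : inl (~: D) \in T by rewrite -[inl (~: D)]/(vertex_opp (inl D))
  -b'E.
have DT : D != setT by apply: contraTneq (aS _ Sb) => ->; rewrite /= inE.
have D0 : ~: D != set0 by apply: contra_neq DT => D0;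
  rewrite -[D]setCK D0 setC0.
have D0' : D != set0.
  by apply: contraTneq (aT _ TD) => ->; rewrite /= setC0 inE.
case: a Sa Ta => [C|k] Sa Ta; last first.
  have /= := cS _ _ Sa Sb; have /= := cT _ _ Ta TD.
  by rewrite (negbTE D0) (negbTE D0') /= inE => /negbTE->.
have CT : C != setT by apply: contraTneq (aS _ Sa) => ->; rewrite /= inE.
have /= /andP[CD] := cS _ _ Sa Sb; have /= /andP[CDc _] := cT _ _ Ta TD.
rewrite (negbTE D0') => /eqP/negbT C0.
case/orP: CD => CD; case/orP: CDc => CDc.
- have : C \subset D :&: ~: D by rewrite subsetI CD.
  by rewrite setICr subset0 (negbTE C0).
- have := subset_trans CDc CD; rewrite -setCS setCK => DcD.
  have : ~: D \subset D :&: ~: D by rewrite subsetI (subset_trans CDc CD) subxx.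
  by rewrite setICr subset0 (negbTE D0).
- have : D \subset D :&: ~: D by rewrite subsetI subxx (subset_trans CD CDc).
  by rewrite setICr subset0 (negbTE D0').
- have : D :|: ~: D \subset C by rewrite subUset CD.
  by rewrite setUCr subTset (negbTE CT).
Qed.

(** Lifts with a common vertex agree by [flag_lift_sub]. Disjoint lifts are antipodal vertex by
    vertex, and neither contains a midpoint, since a midpoint is its own [vertex_opp] and would be
    shared. *)
Lemma flag_lift_unique (n : nat) (i j : 'I_n.+1)
    (S T : {set lifted_vertex n.+1}) :
  flag_avoiding i S -> flag_avoiding j T ->
  @vertex_class n @: S = @vertex_class n @: T ->
  T = S \/ T = @vertex_opp n.+1 @: S /\ (forall k, inr k \notin S).
Proof.
move=> fS fT ST; case: (pickP [pred a | (a \in S) && (a \in T)]) => [a|noa].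
  move=> /andP[Sa Ta]; left; apply/eqP; rewrite eqEsubset.
  by rewrite (flag_lift_sub fT fS (esym ST) Ta Sa) (flag_lift_sub fS fT ST Sa
    Ta).
have noa' a : a \in S -> a \in T -> False.
  by move=> Sa Ta; have := noa a; rewrite /= Sa Ta.
have clST (U V : {set lifted_vertex n.+1}) b : @vertex_class n @: U =
  @vertex_class n @: V ->
    (forall a, a \in U -> a \in V -> False) -> b \in U -> vertex_opp b \in V.
  move=> UV no Ub.
  have /imsetP[b' Vb'] : vertex_class b \in @vertex_class n @: V.
    by rewrite -UV imset_f.
  by move=> /vertex_class_eq[b'E|<-//]; case: (no b) => //; rewrite -b'E.
have oppK : involutive (@vertex_opp n.+1) by case=> //= C; rewrite setCK.
right; split; last first.
  by move=> k; apply/negP => Sk; case: (noa' (inr k)) => //;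
    exact: (clST _ _ _ ST noa' Sk).
apply/setP => b; apply/idP/imsetP => [Tb|[c Sc ->]]; last exact: clST Sc.
exists (vertex_opp b); last by rewrite oppK.
by apply: (clST _ _ _ (esym ST)) Tb => a Ta Sa; exact: (noa' a).
Qed.

(** A set and its complement cannot both avoid [j]. *)
Lemma vertex_class_inj_in (n : nat) (j : 'I_n.+1)
    (S : {set lifted_vertex n.+1}) :
  flag_avoiding j S -> {in S &, injective (@vertex_class n)}.
Proof.
move=> /flag_avoidingP[cS aS] a b Sa Sb /vertex_class_eq[->//|bE].
case: a => [C|//] in Sa bE *; rewrite {b}bE /= in Sb *.
have /= jC := aS _ Sa; have /= := aS _ Sb.
by rewrite inE negbK (negbTE jC).
Qed.

(** The representatives are the [2 ^ n] subsets without [ord0] and the [n + 1] midpoints. Dropping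
    [setT] loses no class, because [set0] represents it too. *)
Lemma vertex_class_count (n : nat) :
  #|[set vertex_class a | a : lifted_vertex n.+1 & a != inl setT]| =
  (2 ^ n + n + 1)%N.
Proof.
have -> : [set vertex_class a | a : lifted_vertex n.+1 & a != inl setT] =
  [set inl C | C in powerset (~: [set ord0 : 'I_n.+1])] :|:
  [set inr i | i : 'I_n.+1].
  apply/setP => b; rewrite inE; apply/imsetP/orP.
    case=> -[C|i] _ -> /=; last by right; rewrite imset_f.
    left; apply: imset_f; rewrite powersetE subsetC sub1set inE.
    by case: (boolP (ord0 \in C)) => C0; rewrite ?inE ?negbK.
  case=> /imsetP[]; last by move=> i _ ->; exists (inr i); rewrite ?inE.
  move=> C; rewrite powersetE subsetC sub1set inE => C0 ->.
  exists (inl C); last by rewrite /= (negbTE C0).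
  by rewrite inE; apply: contra C0 => /eqP[->]; rewrite inE.
rewrite cardsU [X in (_ - X)%N](_ : _ = 0%N) ?subn0.
  rewrite !card_imset; try by move=> ? ? [].
  by rewrite card_powerset cardsC1 !card_ord -addnA addn1.
apply/eqP; rewrite cards_eq0; apply/eqP/setP => b; rewrite !inE.
by apply/negbTE/negP => /andP[/imsetP[C _ ->] /imsetP[]].
Qed.

(** * Barycentric weights on flags and the points they represent *)

Definition weight_support (R : realFieldType) (m : nat)
    (t : lifted_vertex m -> R) : {set lifted_vertex m} := [set a | t a != 0].

Definition flag_weight (R : realFieldType) (m : nat) (j : 'I_m)
    (t : lifted_vertex m -> R) :=
  [/\ forall a, 0 <= t a, \sum_a t a = 1 & flag_avoiding j (weight_support t)].

(* Heights are coordinates in [0, 1]^m, i.e. (1 + x) / 2 for x in [-1, 1]^m. *)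
Definition vertex_height (R : realFieldType) (m : nat) (a : lifted_vertex m)
    (k : 'I_m) : R :=
  match a with inl C => (k \in C)%:R | inr i => (k == i)%:R / 2 end.

Definition weight_point (R : realFieldType) (m : nat)
    (t : lifted_vertex m -> R) (k : 'I_m) : R :=
  \sum_a t a * vertex_height R a k.

Definition flag_level (R : realFieldType) (m : nat)
    (t : lifted_vertex m -> R) : R :=
  \sum_(C : {set 'I_m} | C != set0) t (inl C).

(** Set to zero at [set0], so that every supported layer is nonempty, in accordance with
    [flag_level]. *)
Definition proper_layers (R : realFieldType) (m : nat)
    (t : lifted_vertex m -> R) (C : {set 'I_m}) : R :=
  if C == set0 then 0 else t (inl C).

Lemma weight_pointE (R : realFieldType) (m : nat) (t : lifted_vertex m -> R)
    (k : 'I_m) :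
  weight_point t k = layer_sum (proper_layers t) k + t (inr k) / 2.
Proof.
rewrite /weight_point big_sumType /=; congr (_ + _).
  rewrite /layer_sum [RHS]big_mkcond; apply: eq_bigr => C _.
  case: ifPn => kC; rewrite ?mulr1 ?mulr0// /proper_layers ifN//.
  by apply/set0Pn; exists k.
rewrite (bigD1 k)//= eqxx mul1r big1 ?addr0// => i ik.
by rewrite eq_sym (negbTE ik) mul0r mulr0.
Qed.

Lemma flag_weight_total (R : realFieldType) (m : nat) (j : 'I_m)
    (t : lifted_vertex m -> R) : flag_weight j t ->
  t (inl set0) + flag_level t + \sum_i t (inr i) = 1.
Proof.
by move=> [_ <- _]; rewrite [RHS]big_sumType /= (bigD1 set0).
Qed.

Lemma proper_layers_chain (R : realFieldType) (m : nat) (j : 'I_m)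
    (t : lifted_vertex m -> R) :
  flag_weight j t -> chain_supported (proper_layers t).
Proof.
move=> [t0 _ /flag_avoidingP[ct _]]; split=> [C|C D].
  by rewrite /proper_layers; case: ifP.
rewrite /proper_layers; case: ifP => C0; first by rewrite eqxx.
case: ifP => D0; first by rewrite eqxx.
move=> tC tD; have /= := ct (inl C) (inl D).
by rewrite !inE => /(_ tC tD)/andP[].
Qed.

Lemma layer_le_level (R : realFieldType) (m : nat) (j : 'I_m)
    (t : lifted_vertex m -> R) (k : 'I_m) : flag_weight j t ->
  layer_sum (proper_layers t) k <= flag_level t.
Proof.
move=> ft; have [l0 _] := proper_layers_chain ft.
rewrite /flag_level (eq_bigr (proper_layers t)) => [|C C0].
  by apply: sum_subpred => // C _ kC; apply/set0Pn; exists k.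
by rewrite /proper_layers (negbTE C0).
Qed.

Lemma layer_eq_level (R : realFieldType) (m : nat) (j : 'I_m)
    (t : lifted_vertex m -> R) (k : 'I_m) : flag_weight j t ->
  (forall C, proper_layers t C != 0 -> k \in C) ->
  layer_sum (proper_layers t) k = flag_level t.
Proof.
move=> ft kP; have [l0 _] := proper_layers_chain ft.
rewrite /flag_level (eq_bigr (proper_layers t)) => [|C C0].
  apply: sum_eqpred => // C lC; rewrite kP//; apply/esym/set0Pn.
  by exists k; exact: kP.
by rewrite /proper_layers (negbTE C0).
Qed.

(** Compatibility with the midpoint puts [k] into every supported nonempty set. *)
Lemma midpoint_layer (R : realFieldType) (m : nat) (j : 'I_m)
    (t : lifted_vertex m -> R) (k : 'I_m) : flag_weight j t ->
  t (inr k) != 0 -> layer_sum (proper_layers t) k = flag_level t.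
Proof.
move=> ft tk; apply: (layer_eq_level ft) => C.
case: ft => _ _ /flag_avoidingP[ct _].
rewrite /proper_layers; case: ifPn => C0; first by rewrite eqxx.
move=> tC; have /= := ct (inr k) (inl C).
by rewrite !inE (negbTE C0) => /(_ tk tC).
Qed.

Lemma corner_level (R : realFieldType) (m : nat) (j : 'I_m)
    (t : lifted_vertex m -> R) : flag_weight j t ->
  t (inl set0) != 0 -> flag_level t = 0.
Proof.
move=> [_ _ /flag_avoidingP[ct _]] tz; apply: big1 => C C0; apply/eqP.
apply: contraTT C0 => tC; have /= := ct (inl set0) (inl C).
by rewrite !inE eqxx sub0set => /(_ tz tC) /eqP <-.
Qed.

(** A point of the smallest supported set lies in every supported set of the chain. *)
Lemma level_attained (R : realFieldType) (m : nat) (j : 'I_m)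
    (t : lifted_vertex m -> R) : flag_weight j t -> flag_level t != 0 ->
  exists k, layer_sum (proper_layers t) k = flag_level t.
Proof.
move=> ft L0; have [_ lch] := proper_layers_chain ft.
case: (pickP (fun C : {set 'I_m} => proper_layers t C != 0)) => [C0 lC0|no].
  case: (@arg_minnP _ C0 (fun C : {set 'I_m} => proper_layers t C != 0)
    (fun C : {set 'I_m} => #|C|) lC0) => C lC Cmin.
  have /set0Pn[k kC] : C != set0.
    by apply: contraNneq lC; rewrite /proper_layers => ->; rewrite eqxx.
  exists k; apply: (layer_eq_level ft) => D lD.
  have /orP[/subsetP->//|DC] := lch _ _ lC lD.
  by have /eqP-> : D == C by rewrite eqEcard DC Cmin.
case/eqP: L0; apply: big1 => C C0; have := no C.
by rewrite /proper_layers (negbTE C0) => /negbFE/eqP.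
Qed.

(** If the midpoint at [k] carries weight, the layers at [k] already add up to the level, so its
    contribution is exactly the excess. Otherwise the height is a layer sum and does not exceed the
    level. *)
Lemma excess_over_level (R : realFieldType) (m : nat) (j : 'I_m)
    (t : lifted_vertex m -> R) (k : 'I_m) : flag_weight j t ->
  Num.max (weight_point t k - flag_level t) 0 = t (inr k) / 2.
Proof.
move=> ft; rewrite weight_pointE; have [t0 _ _] := ft.
have [tk|tk] := eqVneq (t (inr k)) 0.
  rewrite tk mul0r addr0; apply: max_r.
  by rewrite subr_le0 (layer_le_level _ ft).
rewrite (midpoint_layer ft tk) addrAC subrr add0r; apply: max_l.
by rewrite divr_ge0.
Qed.

(* Raising the level from L to L' lowers the total excess by at least L' - L,
   whereas the total excess is at most (1 - L) / 2. *)
Lemma flag_level_le (R : realFieldType) (m : nat) (j j' : 'I_m)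
    (t t' : lifted_vertex m -> R) : flag_weight j t -> flag_weight j' t' ->
  weight_point t =1 weight_point t' -> flag_level t' <= flag_level t.
Proof.
move=> ft ft' tt'; rewrite leNgt; apply/negP => LL'.
have L0 : 0 <= flag_level t by apply: sumr_ge0 => C _; case: ft.
have L'0 : flag_level t' != 0 by rewrite gt_eqF// (le_lt_trans L0).
have T := flag_weight_total ft; have T' := flag_weight_total ft'.
(* For [t'] the corner [set0] has no weight, so the total excess equals half of one minus the level;
   for [t] this is only an upper bound. *)
have z0 : 0 <= t (inl set0) by case: ft.
have z'0 : t' (inl set0) = 0 by apply/eqP;
  apply: contraTT L'0 => /(corner_level ft')->; rewrite eqxx.
(* At this coordinate the height is above both levels, so its excess drops by the full difference of
   the levels. *)
have [k Lk] := level_attained ft' L'0.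
have yk : flag_level t' <= weight_point t k.
  by rewrite tt' weight_pointE Lk lerDl divr_ge0//; case: ft'.
have E : \sum_i t (inr i) = 2 * \sum_i Num.max (weight_point t i - flag_level
  t) 0.
  rewrite mulr_sumr; apply: eq_bigr => i _.
  by rewrite (excess_over_level _ ft) mulrC divfK// pnatr_eq0.
have E' : \sum_i t' (inr i) = 2 * \sum_i Num.max (weight_point t i - flag_level
  t') 0.
  rewrite mulr_sumr; apply: eq_bigr => i _.
  by rewrite tt' (excess_over_level _ ft') mulrC divfK// pnatr_eq0.
move: E E'; rewrite [X in 2 * X](bigD1 k)// => E;
  rewrite [X in 2 * X](bigD1 k)// => E'.
rewrite /= !max_l in E E'; try lra.
have : \sum_(i < m | i != k) Num.max (weight_point t i - flag_level t') 0 <=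
  \sum_(i < m | i != k) Num.max (weight_point t i - flag_level t) 0.
  by apply: ler_sum => i _; rewrite ge_max !le_max lerB ?lexx ?orbT// ltW.
lra.
Qed.

(** The point determines the level by [flag_level_le], then the midpoint weights as excesses, then
    the weight of [set0] from the total, and finally the proper corners by [layer_sum_inj]. The full
    set has weight 0 since it avoids no index. *)
Lemma flag_weight_inj (R : realFieldType) (m : nat) (j j' : 'I_m)
    (t t' : lifted_vertex m -> R) : flag_weight j t -> flag_weight j' t' ->
  weight_point t =1 weight_point t' -> t =1 t'.
Proof.
move=> ft ft' tt'; have t't k := esym (tt' k).
have LE : flag_level t = flag_level t'.
  by apply/le_anti;
    rewrite (flag_level_le ft' ft t't) (flag_level_le ft ft' tt').
have iE i : t (inr i) = t' (inr i).
  have := excess_over_level i ft; rewrite tt' LE (excess_over_level i ft').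
  by move/(divIf (_ : 2 != 0 :> R)) => ->//; rewrite pnatr_eq0.
have T := flag_weight_total ft; have T' := flag_weight_total ft'.
have zE : t (inl set0) = t' (inl set0).
  have : \sum_i t (inr i) = \sum_i t' (inr i) by apply: eq_bigr => i _.
  lra.
have lE : layer_sum (proper_layers t) =1 layer_sum (proper_layers t').
  by move=> k; have := tt' k; rewrite !weight_pointE iE => /addIr.
case=> [C|i]; last exact: iE.
have [->//|C0] := eqVneq C set0.
have [->|CT] := eqVneq C setT.
  have outT (k : 'I_m) (s : lifted_vertex m -> R) : flag_weight k s ->
    s (inl setT) = 0.
    case=> _ _ /flag_avoidingP[_ /(_ (inl setT))].
    by rewrite !inE /= inE; case: eqP => //= _ /(_ isT).
  by rewrite (outT _ _ ft) (outT _ _ ft').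
have := layer_sum_inj (proper_layers_chain ft) (proper_layers_chain ft') lE C0
  CT.
by rewrite /proper_layers (negbTE C0).
Qed.

Lemma weight_point_ge0 (R : realFieldType) (m : nat) (j : 'I_m)
    (t : lifted_vertex m -> R) (k : 'I_m) : flag_weight j t ->
  0 <= weight_point t k.
Proof.
move=> [t0 _ _]; apply: sumr_ge0 => -[C|i] _; apply: mulr_ge0 => //=.
by rewrite divr_ge0.
Qed.

Lemma weight_point_avoided (R : realFieldType) (m : nat) (j : 'I_m)
    (t : lifted_vertex m -> R) : flag_weight j t -> weight_point t j = 0.
Proof.
move=> [_ _ /flag_avoidingP[_ h]]; apply: big1 => a _.
have [->|ta] := eqVneq (t a) 0; first by rewrite mul0r.
have := h a; rewrite inE => /(_ ta); case: a {ta} => [C|i] /= /negbTE ->.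
  by rewrite mulr0.
by rewrite mul0r mulr0.
Qed.

Lemma weight_point_level (R : realFieldType) (m : nat) (j : 'I_m)
    (t : lifted_vertex m -> R) (k : 'I_m) : flag_weight j t ->
  2 * weight_point t k <= 1 + flag_level t.
Proof.
move=> ft; rewrite weight_pointE.
have := layer_le_level k ft; have := flag_weight_total ft.
have z0 : 0 <= t (inl set0) by case: ft.
have : t (inr k) <= \sum_i t (inr i).
  rewrite (bigD1 k)//= lerDl; apply: sumr_ge0 => i _; by case: ft.
lra.
Qed.

Lemma weight_point_le1 (R : realFieldType) (m : nat) (j : 'I_m)
    (t : lifted_vertex m -> R) (k : 'I_m) : flag_weight j t ->
  weight_point t k <= 1.
Proof.
move=> ft; have := weight_point_level k ft; have := flag_weight_total ft.
have z0 : 0 <= t (inl set0) by case: ft.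
have : 0 <= \sum_i t (inr i) by apply: sumr_ge0 => i _; case: ft.
lra.
Qed.

(** Height 1 at [k] forces level 1, so neither midpoints nor [set0] carry weight, and the point lies
    in the part of the sphere where the antipodal map acts on flags. All supported sets contain [k],
    hence their complements avoid it. *)
Lemma flag_weight_opp (R : realFieldType) (m : nat) (j k : 'I_m)
    (t : lifted_vertex m -> R) : flag_weight j t -> weight_point t k = 1 ->
  flag_weight k (t \o @vertex_opp m) /\
  forall i, weight_point (t \o @vertex_opp m) i = 1 - weight_point t i.
Proof.
move=> ft y1; have [t0 t1 /flag_avoidingP[ct at_]] := ft.
have := weight_point_level k ft; have T := flag_weight_total ft;
  rewrite y1 => L1.
have z0 := t0 (inl set0).
have i0 : 0 <= \sum_i t (inr i) by apply: sumr_ge0.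
have LE : flag_level t = 1 by lra.
have z0' : t (inl set0) = 0 by lra.
have iE i : t (inr i) = 0.
  have /eqP : \sum_i t (inr i) = 0 by lra.
  by rewrite psumr_eq0// => /allP/(_ i); rewrite mem_index_enum => /(_ isT)/eqP.
(* The layers at [k] already exhaust the level, which leaves no weight for a nonempty set missing
   [k]. *)
have kC C : t (inl C) != 0 -> k \in C.
  apply: contraNT => kC; apply/eqP.
  have C0 : C != set0 \/ C = set0 by case: eqVneq; [right|left].
  case: C0 => [C0|->//]; apply/le_anti; rewrite t0 andbT.
  have := y1;
    rewrite weight_pointE iE mul0r addr0 -LE /flag_level (bigD1 C)//= => h.
  have : layer_sum (proper_layers t) k <=
     \sum_(D : {set 'I_m} | (D != set0) && (D != C)) proper_layers t D.
    apply: sum_subpred; first by case: (proper_layers_chain ft).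
    move=> D _ kD; apply/andP; split; first by apply/set0Pn; exists k.
    by apply: contraNneq kC => <-.
  rewrite h [leRHS](eq_bigr (fun D => t (inl D))) => [|D /andP[D0 _]];
    first lra.
  by rewrite /proper_layers (negbTE D0).
have E f : \sum_(a : lifted_vertex m) t (vertex_opp a) * f a =
           \sum_a t a * f (vertex_opp a).
  rewrite [RHS](reindex_inj (_ : injective (@vertex_opp m))) /=.
    by apply: eq_bigr => -[C|i] _ //=; rewrite setCK.
  by apply: (can_inj (g := @vertex_opp m)) => -[C|i] //=; rewrite setCK.
split; first split.
- by move=> a; exact: t0.
- rewrite -t1; transitivity (\sum_a t (vertex_opp a) * 1).
    by apply: eq_bigr => a _; rewrite mulr1.
  by rewrite (E (fun=> 1)); apply: eq_bigr => a _; rewrite mulr1.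
- apply/flag_avoidingP; split=> [a b|a]; rewrite !inE /=.
    case: a b => [C|i] [D|i'] /=; rewrite ?iE ?eqxx// => tC tD.
    have /= := ct (inl (~: C)) (inl (~: D)); rewrite !inE => /(_ tC tD).
    rewrite !setCS orbC => /andP[-> _] /=.
    have nz (B : {set 'I_m}) : t (inl (~: B)) != 0 -> (B == set0) = false.
      move=> tB; apply: contraTF (at_ (inl (~: B)) _) => [/eqP->|].
        by rewrite /= setC0 inE.
      by rewrite inE.
    by rewrite !nz.
  by case: a => [C|i] /=; rewrite ?iE ?eqxx// => /kC; rewrite inE.
move=> i; rewrite /weight_point /= E -[in RHS]t1 -sumrB;
  apply: eq_bigr => -[C|i'] _ /=.
  by rewrite inE; case: (i \in C); rewrite /= ?mulr0 ?mulr1 ?subr0 ?subrr.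
by rewrite iE !mul0r subr0.
Qed.

(** This is the cut-off corner, where the level is 0. A midpoint has height 1/2, which explains the
    weights [2 * y i]; the rest goes to [set0] and is nonnegative by the bound on the sum. *)
Lemma flag_weight_exists_corner (R : realFieldType) (m : nat) (j : 'I_m)
    (y : 'I_m -> R) : (forall k, 0 <= y k) -> y j = 0 -> \sum_k y k <= 2^-1 ->
  exists2 t, flag_weight j t & weight_point t =1 y.
Proof.
move=> y0 yj sy.
pose t (a : lifted_vertex m) := match a with
  | inl C => if C == set0 then 1 - 2 * \sum_k y k else 0
  | inr i => 2 * y i end.
exists t; last first.
  move=> k; rewrite weight_pointE /= /layer_sum big1 => [|C].
    by rewrite add0r mulrAC mulfV ?mul1r// pnatr_eq0.
  by rewrite /proper_layers /= => _; case: eqP.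
split => [[C|i]||] /=.
- by case: ifP => // _; lra.
- by rewrite mulr_ge0.
- rewrite big_sumType /= (bigD1 set0)//= eqxx [X in _ + X + _]big1 => [|C C0].
    by rewrite -mulr_sumr addr0 subrK.
  by rewrite (negbTE C0).
apply/flag_avoidingP; split=> [a b|a]; rewrite !inE.
  case: a b => [C|i] [D|i'] //=.
  - by case: (eqVneq C set0) => [->|_]; case: (eqVneq D set0) => [->|_];
      rewrite ?eqxx ?subxx.
  - by case: (eqVneq C set0) => //; rewrite eqxx.
  - by move=> _; case: (eqVneq D set0) => //; rewrite eqxx.
case: a => [C|i] /=.
  by case: (eqVneq C set0) => [->|_]; rewrite ?eqxx// inE.
by apply: contraNneq => <-; rewrite yj mulr0.
Qed.

Lemma flag_weight_exists_level (R : realFieldType) (m : nat) (j : 'I_m)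
    (y : 'I_m -> R) (L : R) : (forall k, 0 <= y k) -> y j = 0 -> 0 < L ->
  (exists k, L <= y k) ->
  \sum_k Num.max (y k - L) 0 = (1 - L) / 2 ->
  exists2 t, flag_weight j t & weight_point t =1 y.
Proof.
move=> y0 yj L0 [k0 Lk0] sy.
have w0 k : 0 <= Num.min (y k) L by rewrite le_min y0 ltW.
have [l [l0 lE lw lup]] := layer_cake w0.
pose t (a : lifted_vertex m) := match a with
  | inl C => l C | inr i => 2 * Num.max (y i - L) 0 end.
have lsup C k : l C != 0 -> k \in C -> 0 < Num.min (y k) L.
  move=> lC kC; rewrite -lw /layer_sum (bigD1 C)//= ltr_pwDl//.
    by rewrite lt_def lC l0.
  by apply: sumr_ge0.
(* Supported sets are upward closed for [min (y, L)], whose largest value [L] is taken at [k]. This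
   is what makes the corners compatible with the midpoints. *)
have lmax C k : l C != 0 -> L <= y k -> k \in C.
  move=> lC Lk; have /set0Pn[i iC] : C != set0.
    by apply: contraNneq lC => ->; rewrite lE.
  by apply: lup lC iC _; rewrite [leRHS]min_r// ge_min lexx orbT.
have plE C : proper_layers t C = l C.
  by rewrite /proper_layers; case: eqP => // ->.
exists t; last first.
  move=> k; rewrite weight_pointE /= mulrAC mulfV ?mul1r ?pnatr_eq0//.
  have -> : layer_sum (proper_layers t) k = layer_sum l k by apply: eq_bigr.
  rewrite lw; case: (leP (y k) L) => yL.
    by rewrite max_r ?addr0// subr_le0.
  by rewrite max_l ?subr_ge0 1?ltW// addrC subrK.
split => [[C|i]||] /=.
- exact: l0.
- by rewrite mulr_ge0// le_max lexx orbT.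
- rewrite big_sumType /= -mulr_sumr sy.
  (* Every supported set contains [k0], so the total weight is the layer sum at [k0], where the
     capped height is [L]. *)
  have -> : \sum_C l C = L.
    transitivity (layer_sum l k0); last by rewrite lw min_r.
    by apply: sum_eqpred => // C lC; rewrite (lmax C).
  by rewrite mulrC divfK ?pnatr_eq0// addrC subrK.
have mL i : 2 * Num.max (y i - L) 0 != 0 -> L <= y i.
  by apply: contraNT; rewrite -ltNge => yL; rewrite max_r ?mulr0// subr_le0 ltW.
apply/flag_avoidingP; split=> [a b|a]; rewrite !inE.
  have nz C : l C != 0 -> (C == set0) = false.
    by move=> lC; apply: contraNF lC => /eqP->; rewrite lE.
  case: a b => [C|i] [D|i'] //=; last 2 first.
  - by move=> lC /mL Li; rewrite (lmax C)// orbT.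
  - by move=> /mL Li lC; rewrite (lmax D)// orbT.
  move=> lC lD; rewrite !nz// andbT.
  case: (boolP (C \subset D)) => //= /subsetPn[i iC iD]; apply/subsetP => k kD.
  apply: (lup C i k lC iC); rewrite leNgt; apply/negP => /ltW ki.
  by rewrite (lup _ _ _ lD kD ki) in iD.
case: a => [C|i] /=.
  by move=> lC; apply/negP => jC; have := lsup C j lC jC;
    rewrite yj lt_min ltxx.
by apply: contraNneq => <-; rewrite yj max_r ?mulr0// sub0r oppr_le0 ltW.
Qed.

(** * The quotient complex and its vertices *)

Definition vertex_index (n : nat) (a : lifted_vertex n.+1) :
    'I_#|{: lifted_vertex n.+1}| := enum_rank (vertex_class a).

(** The predicate selects facets of the cube: [predT] yields the whole projective space, [pred1 i]
    the zone of the [i]-th coordinate. *)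
Definition flag_complex (n : nat) (D : pred 'I_n.+1) :
    {set {set 'I_#|{: lifted_vertex n.+1}|}} :=
  [set s : {set 'I_#|{: lifted_vertex n.+1}|} |
    [exists j, [exists S, [&& D j, flag_avoiding j S, S != set0 &
                           s == @vertex_index n @: S]]]].

Definition corner_complex (n : nat) :
    {set {set 'I_#|{: lifted_vertex n.+1}|}} :=
  [set [set vertex_index (inl C)] | C : {set 'I_n.+1} & C != setT].

Lemma vertex_index_opp (n : nat) (a : lifted_vertex n.+1) :
  vertex_index (vertex_opp a) = vertex_index a.
Proof. by rewrite /vertex_index vertex_class_opp. Qed.

Lemma vertex_index_inj_in (n : nat) (j : 'I_n.+1)
    (S : {set lifted_vertex n.+1}) :
  flag_avoiding j S -> {in S &, injective (@vertex_index n)}.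
Proof.
by move=> fS a b Sa Sb /enum_rank_inj; exact: vertex_class_inj_in fS _ _ Sa Sb.
Qed.

Lemma vertex_index_lift_unique (n : nat) (i j : 'I_n.+1)
    (S T : {set lifted_vertex n.+1}) :
  flag_avoiding i S -> flag_avoiding j T ->
  @vertex_index n @: S = @vertex_index n @: T ->
  T = S \/ T = @vertex_opp n.+1 @: S /\ (forall k, inr k \notin S).
Proof.
move=> fS fT ST; apply: flag_lift_unique fS fT _.
apply: (imset_inj (@enum_rank_inj (lifted_vertex n.+1))).
by rewrite -!imset_comp.
Qed.

Lemma flag_complexP (n : nat) (D : pred 'I_n.+1)
    (s : {set 'I_#|{: lifted_vertex n.+1}|}) :
  reflect (exists j S, [/\ D j, flag_avoiding j S, S != set0 &
                           s = @vertex_index n @: S])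
          (s \in flag_complex D).
Proof.
rewrite inE;
  apply: (iffP existsP) => [[j /existsP[S /and4P[Dj fS S0 /eqP sE]]]|].
  by exists j, S.
by case=> j [S [Dj fS S0 sE]]; exists j; apply/existsP; exists S;
  rewrite Dj fS S0 sE /=.
Qed.

Lemma flag_complex_sub (n : nat) (D D' : pred 'I_n.+1) :
  {subset D <= D'} -> flag_complex D \subset flag_complex D'.
Proof.
move=> DD'; apply/subsetP => s /flag_complexP[j [S [Dj fS S0 sE]]].
by apply/flag_complexP; exists j, S; split => //; exact: DD'.
Qed.

Lemma flag_complex_simplicial (n : nat) (D : pred 'I_n.+1) :
  simplicial_complex (flag_complex D).
Proof.
move=> s /flag_complexP[j [S [Dj fS S0 ->]]]; split=> [|t tS t0].
  by rewrite imset_eq0.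
pose T := [set a in S | vertex_index a \in t].
have tE : t = @vertex_index n @: T.
  apply/setP => v; apply/idP/imsetP => [tv|[a]];
    last by rewrite inE => /andP[_ ta] ->.
  have /imsetP[a Sa vE] := subsetP tS _ tv.
  by exists a => //; rewrite inE Sa -vE.
apply/flag_complexP; exists j, T; split => //.
  by apply: flag_avoidingS fS; apply/subsetP => a; rewrite inE => /andP[].
by apply: contra_neq t0 => T0; rewrite tE T0 imset0.
Qed.

Lemma flag_avoiding1 (m : nat) (j : 'I_m) (a : lifted_vertex m) :
  flag_avoiding j [set a] = avoids j a.
Proof.
apply/flag_avoidingP/idP => [[_ h]|ja]; first by apply: h; rewrite inE.
split=> [b c|b]; rewrite !inE => /eqP->//.
by move=> /eqP->; case: a {ja} => //= C; rewrite subxx eqxx.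
Qed.

Lemma corner_complex_simplicial (n : nat) : simplicial_complex (corner_complex
  n).
Proof.
move=> s /imsetP[C C1 ->]; split=> [|t]; first by apply/set0Pn;
  exists (vertex_index (inl C)); rewrite inE.
by rewrite subset1 => /orP[/eqP->|/eqP->]; [move=> _; apply/imsetP;
  exists C | rewrite eqxx].
Qed.

(** A midpoint avoids every index but its own, so two coordinates are enough. *)
Lemma avoids_exists (n : nat) (a : lifted_vertex n.+2) :
  a != inl setT -> exists j, avoids j a.
Proof.
case: a => [C CT|i _].
  apply/existsP; apply: contraNT CT => /existsPn h; apply/eqP; congr inl.
  by apply/setP => x; rewrite inE; have := h x; rewrite negbK.
have [i0|i0] := eqVneq i ord0; first by exists (lift ord0 ord0); rewrite /= i0.
by exists ord0; rewrite /= eq_sym.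
Qed.

Lemma corner_complex_sub (n : nat) :
  corner_complex n.+1 \subset flag_complex (@predT 'I_n.+2).
Proof.
apply/subsetP => s /imsetP[C]; rewrite inE => CT ->.
have [j jC] : exists j, avoids j (inl C).
  by apply: avoids_exists; apply: contra CT => /eqP[->].
apply/flag_complexP; exists j, [set inl C]; rewrite flag_avoiding1 imset_set1.
by split => //; apply/set0Pn; exists (inl C); rewrite inE.
Qed.

Lemma card_vertices_flag_complex (n : nat) :
  #|vertices (flag_complex (@predT 'I_n.+2))| = (2 ^ n.+1 + n.+1 + 1)%N.
Proof.
rewrite -vertex_class_count.
rewrite -(card_imset _ (@enum_rank_inj (lifted_vertex n.+2)));
  apply: eq_card => v.
rewrite inE -imset_comp; apply/flag_complexP/imsetP.
  case=> j [S [_ /flag_avoidingP[_ aS] S0 vE]]; have /set0Pn[a Sa] := S0.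
  exists a; first by rewrite inE; apply: contraTneq (aS _ Sa) => ->;
    rewrite /= inE.
  by have /set1P : vertex_index a \in [set v] by rewrite vE imset_f.
move=> [a]; rewrite inE => aT ->; have [j ja] := avoids_exists aT.
exists j, [set a]; rewrite flag_avoiding1 imset_set1.
by split => //; apply/set0Pn; exists a; rewrite inE.
Qed.

From mathcomp Require Import all_classical all_reals all_analysis.
Import Order.TTheory GRing.Theory Num.Theory.
Import numFieldNormedType.Exports.
Local Open Scope classical_set_scope.
Local Open Scope quotient_scope.

(** * Compactness, and the topology of projective space *)

Lemma compact_injective_inverse (S : ptopologicalType) (T : topologicalType)
    (A : set S) (f : S -> T) :
  hausdorff_space T -> compact A -> {within A, continuous f} ->
  {in A &, injective f} ->
  exists g : T -> S, [/\ {within f @` A, continuous g},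
    g @` (f @` A) `<=` A, {in A, cancel f g} & {in f @` A, cancel g f}].
Proof.
move=> hT cA cf injf.
have [g gP] : exists g : T -> S,
    forall y, (f @` A) y -> A (g y) /\ f (g y) = y.
  exists (fun y => xget point [set x | A x /\ f x = y]) => y [x Ax fx].
  exact: (@xgetPex _ point [set x |
    A x /\ f x = y] (ex_intro _ x (conj Ax fx))).
have fK x : A x -> g (f x) = x.
  move=> Ax; have [|Ag fg] := gP (f x); first by exists x.
  by apply: injf => //; exact/mem_set.
exists g; split; first 1 last.
- by move=> _ [y /gP[Ay _] <-].
- by move=> x /set_mem; exact: fK.
- by move=> y /set_mem /gP[].
apply/continuous_closedP => W cW; apply/closed_subspaceP.
exists (f @` (A `&` W)).
  apply: (compact_closed hT); apply: continuous_compact.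
    by apply: continuous_subspaceW cf => x [].
  by apply: compact_closedI.
apply/seteqP; split=> y /=.
  case=> -[x [Ax Wx] <-] _; split; last by exists x.
  by rewrite /from_subspace fK.
case=> Wy fAy; split => //; exists (g y); last by case: (gP y fAy).
by case: (gP y fAy).
Qed.

Lemma compact_homeomorphism (S : ptopologicalType) (T : topologicalType)
    (A : set S) (f : S -> T) :
  hausdorff_space T -> compact A -> {within A, continuous f} ->
  {in A &, injective f} -> homeomorphism_between A (f @` A) f.
Proof.
move=> hT cA cf injf.
by have [g [cg gA fg gf]] := compact_injective_inverse hT cA cf injf; exists g;
  split.
Qed.

(** Zones are charted by maps out of the manifold, whereas the parametrization goes into it; the
    cancellation identifies the inverse for the proof of equivariance. *)
Lemma compact_homeomorphism_inv (S : ptopologicalType) (T : topologicalType)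
    (A : set S) (f : S -> T) :
  hausdorff_space T -> compact A -> {within A, continuous f} ->
  {in A &, injective f} ->
  exists2 g, homeomorphism_between (f @` A) A g & {in A, cancel f g}.
Proof.
move=> hT cA cf injf.
have [g [cg gA fg gf]] := compact_injective_inverse hT cA cf injf.
by exists g => //; exists f; split.
Qed.

Lemma hausdorff_separating (R : realType) (T : topologicalType) :
  (forall x y : T, (forall f : T -> R, continuous f -> f x = f y) -> x = y) ->
  hausdorff_space T.
Proof.
move=> sepT x y cxy; apply: sepT => f cf; apply: (@Rhausdorff R) => A B fA fB.
by have [z [Az Bz]] := cxy _ _ (cf _ _ fA) (cf _ _ fB); exists (f z).
Qed.

Lemma cvg_rV (R : realType) (T : Type) (F : set_system T) (FF : Filter F)
    (n : nat) (f : T -> 'rV[R]_n) (l : 'rV[R]_n) :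
  (forall i, (fun x => f x 0 i) @ F --> l 0 i) -> f @ F --> l.
Proof.
move=> fl A [P lP sPA].
have : F [set x | forall i, P 0 i (f x 0 i)].
  apply: (@filter_forall _ _ (fun i x => P 0 i (f x 0 i))) => i.
  exact: fl (lP 0 i).
move=> FP; change (F (f @^-1` A)); apply: filterS FP => x Px; apply: sPA => i j.
by rewrite (ord1 i).
Qed.

(** Pasting lemma, which assembles a map on a realization from its closed simplices. *)
Lemma within_bigcup_continuous (S T : topologicalType) (I : choiceType)
    (D : set I) (A : I -> set S) (f : S -> T) :
  finite_set D -> (forall i, D i -> closed (A i)) ->
  (forall i, D i -> {within A i, continuous f}) ->
  {within \bigcup_(i in D) A i, continuous f}.
Proof.
move=> fD cA cf; apply/continuous_closedP => W cW; apply/closed_subspaceP.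
exists (\bigcup_(i in D) (A i `&` f @^-1` W)).
  apply: closed_bigcup => // i Di.
  have /continuous_closedP/(_ _ cW)/closed_subspaceP[V cV] := cf i Di.
  by rewrite [A i `&` _]setIC => <-; apply: closedI => //; exact: cA.
apply/seteqP; split=> x /=.
  by case=> -[i Di [Aix Wx]] _; split => //; exists i.
by case=> Wx [i Di Aix]; split; exists i.
Qed.

Lemma continuous_sumr (R : realType) (T : topologicalType) (I : finType)
    (P : pred I) (f : I -> T -> R) :
  (forall i, P i -> continuous (f i)) ->
  continuous (fun x => \sum_(i | P i) f i x).
Proof.
move=> cf x; apply: cvg_big => [|i Pi]; last exact: cf.
exact: add_continuous.
Qed.

Lemma continuous_rV (R : realType) (T : topologicalType) (n : nat)
    (f : T -> 'rV[R]_n) (x : T) :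
  (forall i, {for x, continuous (fun y => f y 0 i)}) -> {for x, continuous f}.
Proof. by move=> cf; exact: (cvg_rV (nbhs_filter x) cf). Qed.

(** * The quotient map onto projective space *)

Lemma ones_neq0 (R : realType) (n : nat) :
  (const_mx 1 : 'rV[R]_n.+1) \in @nonzero_vectors R n.+1.
Proof.
apply/mem_set; apply/eqP => /matrixP/(_ 0 0)/eqP; rewrite !mxE.
by rewrite oner_eq0.
Qed.

(* A total version of the quotient map, constant (= [1 : ... : 1]) at 0. *)
Definition RP_of (R : realType) (n : nat) (x : 'rV[R]_n.+1) : RP R n :=
  \pi_(RP R n) (insubd (SigSub (ones_neq0 R n) : punctured R n.+1) x).

Lemma val_insubd_punctured (R : realType) (n : nat) (u : punctured R n.+1)
    (x : 'rV[R]_n.+1) : x != 0 -> val (insubd u x) = x.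
Proof. by move=> x0; rewrite insubdK//; exact/mem_set. Qed.

Lemma RP_of_surj (R : realType) (n : nat) (q : RP R n) :
  exists2 x : 'rV[R]_n.+1, x != 0 & q = RP_of x.
Proof.
have x0 : val (repr q) != 0 := set_valP (repr q).
exists (val (repr q)) => //; rewrite -[LHS]reprK /RP_of; congr (\pi_(RP R n) _).
by apply: val_inj; rewrite /= val_insubd_punctured.
Qed.

Lemma RP_of_eq (R : realType) (n : nat) (x y : 'rV[R]_n.+1) :
  x != 0 -> y != 0 ->
  RP_of x = RP_of y <-> exists2 c : R, c != 0 & y = c *: x.
Proof.
by move=> x0 y0; rewrite /RP_of RP_piP !val_insubd_punctured.
Qed.

Lemma RP_ofZ (R : realType) (n : nat) (c : R) (x : 'rV[R]_n.+1) :
  c != 0 -> x != 0 -> RP_of (c *: x) = RP_of x.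
Proof.
move=> c0 x0; apply/esym/RP_of_eq => //; last by exists c.
by rewrite scaler_eq0 negb_or c0.
Qed.

Lemma lift_sign_act_eq0 (R : realType) (n : nat) (g : 'rV['F_2]_n)
    (x : 'rV[R]_n.+1) : x != 0 -> lift_sign_act g x != 0.
Proof.
move=> x0; have xP : x \in @nonzero_vectors R n.+1 by exact/mem_set.
by have /set_mem := lift_sign_act_neq0 g (SigSub xP : punctured R n.+1).
Qed.

Lemma RP_act_of (R : realType) (n : nat) (g : 'rV['F_2]_n)
    (x : 'rV[R]_n.+1) :
  x != 0 -> RP_act g (RP_of x) = RP_of (lift_sign_act g x).
Proof.
move=> x0; rewrite /RP_of RP_act_pi; congr (\pi_(RP R n) _).
by apply: val_inj; rewrite /= !val_insubd_punctured// lift_sign_act_eq0.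
Qed.

Lemma RP_orbit_map_of (R : realType) (n : nat) (x : 'rV[R]_n.+1) :
  x != 0 -> RP_orbit_map (RP_of x) = orbit_coordinates x.
Proof. by move=> x0; rewrite /RP_of RP_orbit_map_pi val_insubd_punctured. Qed.

Lemma RP_of_continuous (R : realType) (n : nat) (x : 'rV[R]_n.+1) :
  x != 0 -> {for x, continuous (@RP_of R n)}.
Proof.
move=> x0 A; rewrite nbhsE => -[U [oU Ux] UA].
(* Open in the quotient means that the preimage is open in the punctured space, i.e. the trace of an
   open set [V] of the ambient space. *)
have [V oV VU] : open (\pi_(RP R n) @^-1` U : set (punctured R n.+1)) := oU.
change (nbhs x (@RP_of R n @^-1` A)).
have UV y : y != 0 -> U (RP_of y) = V y.
  move=> y0; have := congr1 (fun W : set _ => W (insubd (SigSub (ones_neq0 R n)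
    : punctured R n.+1) y)) VU.
  by rewrite /preimage /= -/(RP_of y) => <-; congr V;
    exact: val_insubd_punctured.
have Vx : nbhs x V by apply: open_nbhs_nbhs; split => //; rewrite -UV.
have nx : nbhs x [set y : 'rV[R]_n.+1 | y != 0].
  apply: open_nbhs_nbhs; split => //.
  rewrite (_ : mkset _ = ~` [set 0]); last first.
    by apply/seteqP; split => y /= /eqP.
  apply: closed_openC; apply: accessible_closed_set1.
  exact/hausdorff_accessible/norm_hausdorff.
by apply: filterS2 nx Vx => y y0 Vy; apply: UA; rewrite UV.
Qed.

Lemma RP_lift_continuous (R : realType) (n : nat) (F : 'rV[R]_n.+1 -> R) :
  (forall x, x != 0 -> {for x, continuous F}) ->
  (forall c x, c != 0 -> F (c *: x) = F x) ->
  exists2 f : RP R n -> R, continuous f & forall x, x != 0 -> f (RP_of x) = F x.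
Proof.
move=> cF FZ.
have FE (x y : punctured R n.+1) : \pi_(RP R n) x = \pi_(RP R n) y ->
    F (val x) = F (val y).
  by move=> /RP_piP[c c0 ->]; rewrite FZ.
exists ((fun x : punctured R n.+1 => F (val x)) \o repr).
  apply: repr_comp_continuous => [x|x y /eqP xy]; last exact/eqP/FE.
  apply: (@continuous_comp _ _ _ (set_val : punctured R n.+1 -> _) F).
    exact: initial_continuous.
  by apply: cF; exact: (set_valP x).
move=> x x0 /=; rewrite -[in RHS](val_insubd_punctured
  (SigSub (ones_neq0 R n) : punctured R n.+1) x0).
by apply: FE; rewrite reprK.
Qed.

Lemma coord_ratio_continuous (R : realType) (n : nat) (i j : 'I_n.+1)
    (x : 'rV[R]_n.+1) : x != 0 ->
  {for x, continuous (fun y : 'rV[R]_n.+1 =>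
    y 0 i * y 0 j / \sum_k y 0 k ^+ 2)}.
Proof.
move=> x0; apply: continuousM; first by apply: continuousM;
  exact: coord_continuous.
apply: continuousV; first by rewrite gt_eqF// sum_sqr_gt0.
by apply: continuous_sumr => k _ y; apply: continuousM; exact: coord_continuous.
Qed.

Lemma coord_ratioZ (R : realType) (n : nat) (i j : 'I_n.+1) (c : R)
    (x : 'rV[R]_n.+1) : c != 0 ->
  (c *: x) 0 i * (c *: x) 0 j / \sum_k (c *: x) 0 k ^+ 2 =
  x 0 i * x 0 j / \sum_k x 0 k ^+ 2.
Proof.
move=> c0; under eq_bigr do rewrite mxE exprMn.
rewrite -mulr_sumr !mxE mulrACA -expr2 invfM mulrACA divff ?mul1r//.
by rewrite expf_neq0.
Qed.

(* The entries x_i x_j / |x|^2 of the projector onto the line separate points. *)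
Lemma RP_hausdorff (R : realType) (n : nat) : hausdorff_space (RP R n).
Proof.
apply: (@hausdorff_separating R) => p q.
have [x x0 ->] := RP_of_surj p; have [y y0 ->] := RP_of_surj q => fE.
have E i j : x 0 i * x 0 j / \sum_k x 0 k ^+ 2 =
             y 0 i * y 0 j / \sum_k y 0 k ^+ 2.
  have [f cf fP] := RP_lift_continuous (@coord_ratio_continuous R n i j)
    (@coord_ratioZ R n i j).
  by rewrite -!fP//; exact: fE.
have sx := sum_sqr_gt0 x0; have sy := sum_sqr_gt0 y0.
set u := \sum_k x 0 k ^+ 2 in E sx; set v := \sum_k y 0 k ^+ 2 in E sy.
(* The diagonal entry at [i] gives [x 0 i != 0]; comparing the entries [(i, j)] and [(i, i)] then
   shows that [y] is [x] scaled by [y 0 i / x 0 i]. *)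
have [i yi] : exists i, y 0 i != 0.
  apply/existsP; apply: contra_neqT y0 => /existsPn h.
  by apply/rowP => i; rewrite mxE; apply/eqP; have := h i; rewrite negbK.
have xi : x 0 i != 0.
  apply: contra_neq yi => xi0; have /eqP := E i i.
  rewrite xi0 !mul0r eq_sym !mulf_eq0 invr_eq0 (gt_eqF sy) orbF orbb.
  by move=> /eqP.
apply/RP_of_eq => //; exists (y 0 i / x 0 i).
  by rewrite mulf_neq0// invr_neq0.
apply/rowP => j; rewrite mxE; have := E i i; have := E i j => Eij Eii.
have h : (x 0 i * x 0 j / u) * (y 0 i * y 0 i / v) =
         (y 0 i * y 0 j / v) * (x 0 i * x 0 i / u) by rewrite Eij -Eii.
have : y 0 j * x 0 i = y 0 i * x 0 j; last first.
  by move=> e; rewrite mulrAC -e mulfK.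
have k0 : x 0 i * y 0 i / (u * v) != 0.
  by rewrite !mulf_neq0// invr_neq0// mulf_neq0// gt_eqF.
apply: (mulfI k0); move: h; rewrite !invfM => h.
have := h; set a := x 0 i; set b := y 0 i; set d := u^-1; set e := v^-1 => h'.
by transitivity ((y 0 i * y 0 j / v) * (x 0 i * x 0 i / u));
  [rewrite -/a -/b -/d -/e; ring | rewrite -h -/a -/b -/d -/e; ring].
Qed.

Lemma RP_orbit_map_continuous (R : realType) (n : nat) (i : 'I_n.+1) :
  continuous (fun q : RP R n => RP_orbit_map q 0 i).
Proof.
have [f cf fP] := RP_lift_continuous (@coord_ratio_continuous R n i i)
  (@coord_ratioZ R n i i).
rewrite (_ : (fun q => _) = f)//; apply/funext => q.
have [x x0 ->] := RP_of_surj q; rewrite fP// RP_orbit_map_of// mxE.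
by rewrite -expr2.
Qed.

(** * The triangulation *)

(** Intermediate value theorem for the total excess minus [(1 - L) / 2] between 0 and the largest
    height: positive at 0 because the heights sum to more than 1/2, nonpositive at the other end
    because heights are at most 1. *)
Lemma level_exists (R : realType) (m : nat) (y : 'I_m -> R) :
  (forall k, 0 <= y k <= 1) -> 2^-1 < \sum_k y k ->
  exists L, [/\ 0 < L, exists k, L <= y k &
    \sum_k Num.max (y k - L) 0 = (1 - L) / 2].
Proof.
move=> y01 sy.
have [i0 _] : exists i0 : 'I_m, true.
  case: (pickP (fun _ : 'I_m => true)) => [i _|no]; first by exists i.
  by move: sy; rewrite big_pred0// ltNge invr_ge0 ler0n.
case: (@arg_maxP _ _ _ i0 predT y isT) => k _ kmax.
pose f L := \sum_k Num.max (y k - L) 0 - (1 - L) / 2.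
have cf : continuous f.
  move=> L; rewrite /f; apply: cvgB; last first.
    by apply: cvgM; [apply: cvgB;
      [exact: cvg_cst | exact: cvg_id] | exact: cvg_cst].
  apply: continuous_sumr => i _ x;
    apply: (@continuous_max R R (fun x => y i - x) (cst 0)).
    by apply: cvgB; [exact: cvg_cst | exact: cvg_id].
  exact: cvg_cst.
have /andP[yk0 yk1] := y01 k.
have f0 : 0 < f 0.
  rewrite /f (eq_bigr y) => [|i _]; first lra.
  by rewrite subr0 max_l//; have /andP[] := y01 i.
have fk : f (y k) <= 0.
  rewrite /f big1 => [|i _]; first lra.
  by rewrite max_r// subr_le0; exact: kmax.
have [|L] := @IVT R f 0 (y k) 0 yk0 (continuous_subspaceT cf).
  by rewrite ge_min le_max fk orbT/= ltW.
rewrite in_itv /= => /andP[L0 Lk] fL; exists L; split.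
- by rewrite lt_def L0 andbT; apply: contra_ltN f0 => /eqP <-; rewrite fL.
- by exists k.
- by apply/eqP; rewrite -subr_eq0 -/(f L) fL.
Qed.

Lemma flag_weight_exists (R : realType) (m : nat) (j : 'I_m) (y : 'I_m -> R) :
  (forall k, 0 <= y k <= 1) -> y j = 0 ->
  exists2 t, flag_weight j t & weight_point t =1 y.
Proof.
move=> y01 yj; have y0 k : 0 <= y k by have /andP[] := y01 k.
have [sy|sy] := leP (\sum_k y k) 2^-1.
  exact: flag_weight_exists_corner.
have [L [L0 Lk sL]] := level_exists y01 sy.
exact: flag_weight_exists_level L0 Lk sL.
Qed.

Definition closed_face (R : realType) (p : nat) (B : {set 'I_p}) : set 'rV[R]_p
  :=
  [set t | [/\ forall i, 0 <= t 0 i, \sum_i t 0 i = 1 &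
               forall i, i \notin B -> t 0 i = 0]].

Definition point_support (R : realType) (p : nat) (t : 'rV[R]_p) : {set 'I_p} :=
  [set i | t 0%R i != 0%R]%SET.

Definition lift_point (R : realType) (n : nat) (S : {set lifted_vertex n.+1})
    (t : 'rV[R]_#|{: lifted_vertex n.+1}|) : 'rV[R]_n.+1 :=
  \row_k \sum_(a in S) t 0 (vertex_index a) * (2 * vertex_height R a k - 1).

Definition lift_weight (R : realType) (n : nat) (S : {set lifted_vertex n.+1})
    (t : 'rV[R]_#|{: lifted_vertex n.+1}|) (a : lifted_vertex n.+1) : R :=
  if a \in S then t 0 (vertex_index a) else 0.

Definition push_weight (R : realType) (n : nat) (w : lifted_vertex n.+1 -> R) :
    'rV[R]_#|{: lifted_vertex n.+1}| :=
  \row_v \sum_(a | vertex_index a == v) w a.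

(** Supports of points of the complex always have a lift, so the empty default is not reached there.
    The choice of the lift matters only up to the antipodal map. *)
Definition flag_of (n : nat) (s : {set 'I_#|{: lifted_vertex n.+1}|}) :
    {set lifted_vertex n.+1} :=
  odflt finset.set0 [pick S | [exists j, flag_avoiding j S] &&
                             (@vertex_index n @: S == s)]%SET.

Definition RP_triangulation (R : realType) (n : nat)
    (t : 'rV[R]_#|{: lifted_vertex n.+1}|) : RP R n :=
  RP_of (lift_point (flag_of (point_support t)) t).

Lemma closed_face_compact (R : realType) (p : nat) (B : {set 'I_p}) :
  compact (@closed_face R p B).
Proof.
apply: (@subclosed_compact _ _ [set t : 'rV[R]_p |
  forall i, `[0, 1]%classic (t ord0 i)]).
- rewrite (_ : closed_face B = \bigcap_(i in setT) [set t : 'rV[R]_p |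
    0 <= t 0 i] `&`
    [set t : 'rV[R]_p | \sum_i t 0 i = 1] `&`
    \bigcap_(i in [set i | i \notin B]) [set t : 'rV[R]_p | t 0 i = 0]).
    apply: closedI; first apply: closedI.
    + apply: closed_bigI => i _.
      apply: (@preimage_closed _ _ (fun t : 'rV[R]_p =>
        t 0 i) [set x | 0 <= x]).
        by move=> t _; exact: coord_continuous.
      exact: closed_ge.
    + apply: (@preimage_closed _ _ (fun t : 'rV[R]_p =>
      \sum_i t 0 i) [set x | x = 1]).
        by move=> t _; apply: continuous_sumr => i _; exact: coord_continuous.
      exact: closed_eq.
    + apply: closed_bigI => i _.
      apply: (@preimage_closed _ _ (fun t : 'rV[R]_p => t 0 i) [set x | x = 0]).
        by move=> t _; exact: coord_continuous.
      exact: closed_eq.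
  apply/seteqP; split=> t /=.
    case=> t0 t1 tB; split; last by move=> i iB; exact: tB.
    by split=> [i _|]; [exact: t0 | exact: t1].
  by case=> -[t0 t1] tB; split=> [i||i iB]; [exact: t0 | exact: t1 | exact: tB].
- apply: (@rV_compact R p (fun=> `[0, 1]%classic)) => i.
  exact: segment_compact.
move=> t [t0 t1 _] i /=; rewrite in_itv /= t0 -t1 (bigD1 i)//= lerDl.
by apply: sumr_ge0.
Qed.

Lemma realization_closed_face (R : realType) (p : nat) (X : {set {set 'I_p}}) :
  simplicial_complex X ->
  realization R X = \bigcup_(B in [set` X]) closed_face B.
Proof.
move=> sX; apply/seteqP; split=> t /=.
  case=> t0 t1 tX; exists (point_support t) => //; split => // i.
  by rewrite inE negbK => /eqP.
case=> B XB [t0 t1 tB]; split => //; apply: (sX _ XB).2.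
  apply/fintype.subsetP => i; rewrite inE; apply: contraR => iB.
  by rewrite tB.
apply/eqP => e; have : \sum_i t 0 i = 0.
  apply: big1 => i _; apply/eqP.
  by have := congr1 (fun A : {set 'I_p} => i \in A) e; rewrite !inE => /negbFE.
by rewrite t1 => /eqP; rewrite oner_eq0.
Qed.

Lemma realization_compact (R : realType) (p : nat) (X : {set {set 'I_p}}) :
  simplicial_complex X -> compact (realization R X).
Proof.
move=> sX; rewrite realization_closed_face// -bigsetU_fset_set;
  last exact: finite_finset.
apply: bigsetU_compact => B _; exact: closed_face_compact.
Qed.

Lemma lift_pointE (R : realType) (n : nat) (S : {set lifted_vertex n.+1})
    (t : 'rV[R]_#|{: lifted_vertex n.+1}|) (k : 'I_n.+1) :
  \sum_a lift_weight S t a = 1 ->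
  lift_point S t 0 k = 2 * weight_point (lift_weight S t) k - 1.
Proof.
move=> s1; rewrite mxE /weight_point mulr_sumr -[X in _ - X]s1 -sumrB
  big_mkcond.
apply: eq_bigr => a _; rewrite /lift_weight; case: ifP => _; first by ring.
by rewrite mul0r mulr0 subr0.
Qed.

Lemma lift_weight_flag (R : realType) (n : nat) (j : 'I_n.+1)
    (S : {set lifted_vertex n.+1}) (t : 'rV[R]_#|{: lifted_vertex n.+1}|) :
  flag_avoiding j S -> closed_face (@vertex_index n @: S)%SET t ->
  flag_weight j (lift_weight S t).
Proof.
move=> fS [t0 t1 tS]; split.
- by move=> a; rewrite /lift_weight; case: ifP.
- rewrite /lift_weight -big_mkcond /= -t1.
  rewrite [RHS](bigID (mem (@vertex_index n @: S)%SET)) /= [X in _ + X]big1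
    ?addr0.
    by rewrite (big_imset _ (vertex_index_inj_in fS)).
  by move=> i; exact: tS.
- apply: flag_avoidingS fS; apply/fintype.subsetP => a;
    rewrite inE /lift_weight.
  by case: ifP; rewrite ?eqxx.
Qed.

Lemma push_lift_weight (R : realType) (n : nat) (j : 'I_n.+1)
    (S : {set lifted_vertex n.+1}) (t : 'rV[R]_#|{: lifted_vertex n.+1}|) :
  flag_avoiding j S -> closed_face (@vertex_index n @: S)%SET t ->
  push_weight (lift_weight S t) = t.
Proof.
move=> fS [t0 t1 tS]; apply/rowP => v; rewrite mxE.
have [/imsetP[a Sa vE]|vS] := boolP (v \in (@vertex_index n @: S)%SET);
  last first.
  rewrite tS// big1// => a /eqP vE; rewrite /lift_weight ifN//.
  by apply: contra vS => Sa; rewrite -vE imset_f.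
rewrite (bigD1 a) ?vE//= /lift_weight Sa big1 ?addr0// => b /andP[/eqP ba nba].
rewrite ifN//; apply: contra nba => Sb; apply/eqP.
exact: vertex_index_inj_in fS _ _ Sb Sa ba.
Qed.

Lemma push_weightK (R : realType) (n : nat) (j : 'I_n.+1)
    (w : lifted_vertex n.+1 -> R) : flag_weight j w ->
  lift_weight (weight_support w) (push_weight w) =1 w.
Proof.
move=> [w0 w1 fw] a; rewrite /lift_weight inE; case: eqP => //= /eqP wa.
rewrite mxE (bigD1 a)//= big1 ?addr0// => b /andP[/eqP ba nba].
apply: contraNeq nba => wb; apply/eqP.
by apply: vertex_index_inj_in fw _ _ _ _ ba; rewrite inE.
Qed.

Lemma push_weight_face (R : realType) (n : nat) (j : 'I_n.+1)
    (w : lifted_vertex n.+1 -> R) : flag_weight j w ->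
  closed_face (@vertex_index n @: weight_support w)%SET (push_weight w) /\
  point_support (push_weight w) = (@vertex_index n @: weight_support w)%SET.
Proof.
move=> fw; have [w0 w1 fS] := fw.
have z (v : 'I_#|{: lifted_vertex n.+1}|) :
    v \notin (@vertex_index n @: weight_support w)%SET -> push_weight w 0 v = 0.
  move=> vS; rewrite mxE big1// => a /eqP vE; apply/eqP.
  by apply: contraNT vS => wa; rewrite -vE imset_f// inE.
split; first split=> //.
- by move=> i; rewrite mxE; apply: sumr_ge0.
- rewrite -[RHS]w1 (partition_big (@vertex_index n) predT)//=.
  by apply: eq_bigr => i _; rewrite mxE.
apply/setP => v; rewrite inE; apply/idP/idP => [|/imsetP[a]].
  by apply: contraR => /z->.
move=> Sa ->; have := push_weightK fw a; rewrite /lift_weight Sa => ->.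
by move: Sa; rewrite inE.
Qed.

Lemma lift_point_sub (R : realType) (n : nat) (S T : {set lifted_vertex n.+1})
    (t : 'rV[R]_#|{: lifted_vertex n.+1}|) : T \subset S ->
  (forall a, a \in S -> a \notin T -> t 0 (vertex_index a) = 0) ->
  lift_point S t = lift_point T t.
Proof.
move=> TS tz; apply/rowP => k; rewrite !mxE (big_setID T) /=.
rewrite (finset.setIidPr TS) [X in _ + X]big1 ?addr0// => a.
by rewrite !inE => /andP[aT aS]; rewrite tz// mul0r.
Qed.

Lemma lift_point_opp (R : realType) (n : nat) (S : {set lifted_vertex n.+1})
    (t : 'rV[R]_#|{: lifted_vertex n.+1}|) : (forall k, inr k \notin S) ->
  lift_point (@vertex_opp n.+1 @: S)%SET t = - lift_point S t.
Proof.
move=> nS; apply/rowP => k; rewrite !mxE big_imset /=; last first.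
  move=> a b _ _; apply: (can_inj (g := @vertex_opp n.+1)) => -[C|i] //=.
  by rewrite finset.setCK.
rewrite -sumrN; apply: eq_bigr => -[C|i] Sa; last by have := nS i; rewrite Sa.
rewrite vertex_index_opp /= inE; case: (k \in C) => /=; ring.
Qed.

Lemma lift_point_neq0 (R : realType) (n : nat) (j : 'I_n.+1)
    (S : {set lifted_vertex n.+1}) (t : 'rV[R]_#|{: lifted_vertex n.+1}|) :
  flag_avoiding j S -> closed_face (@vertex_index n @: S)%SET t ->
  lift_point S t 0 j = -1 /\ lift_point S t != 0.
Proof.
move=> fS tS; have fw := lift_weight_flag fS tS.
have e : lift_point S t 0 j = -1.
  by rewrite lift_pointE;
    [rewrite (weight_point_avoided fw) mulr0 sub0r | case: fw].
split=> //; apply/eqP => z; move/eqP: e; rewrite z mxE eq_sym oppr_eq0.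
by rewrite oner_eq0.
Qed.

(** Any lift computes the map. After shrinking [S] to the support of [t], the lift picked by
    [flag_of] is either the same or antipodal without midpoints; in the latter case the lifted point
    changes its sign only. *)
Lemma RP_triangulation_lift (R : realType) (n : nat) (j : 'I_n.+1)
    (S : {set lifted_vertex n.+1}) (t : 'rV[R]_#|{: lifted_vertex n.+1}|) :
  flag_avoiding j S -> closed_face (@vertex_index n @: S)%SET t ->
  RP_triangulation t = RP_of (lift_point S t).
Proof.
move=> fS tS; have [t0 t1 tz] := tS.
pose T := [set a in S | t 0%R (vertex_index a) != 0%R]%SET.
have TS : T \subset S by apply/fintype.subsetP => a; rewrite inE => /andP[].
have fT := flag_avoidingS TS fS.
have sT : (@vertex_index n @: T)%SET = point_support t.
  apply/setP => v; rewrite inE; apply/imsetP/idP => [[a]|tv].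
    by rewrite inE => /andP[_ ta] ->.
  have /imsetP[a Sa vE] : v \in (@vertex_index n @: S)%SET.
    by apply: contraNT tv => /tz->.
  by exists a => //; rewrite inE Sa -vE.
have STt : lift_point S t = lift_point T t.
  apply: lift_point_sub => // a Sa; rewrite inE Sa /= negbK => /eqP.
  by [].
have tT : closed_face (@vertex_index n @: T)%SET t.
  by split => // i; rewrite sT inE negbK => /eqP.
rewrite /RP_triangulation STt /flag_of;
  case: pickP => [U /= /andP[/existsP[i fU] /eqP sU]|no]; last first.
  by have := no T; rewrite sT eqxx andbT => /existsPn/(_ j); rewrite fT.
have [->//|[-> nT]] := vertex_index_lift_unique fT fU (etrans sT (esym sU)).
have [_ l0] := lift_point_neq0 fT tT.
by rewrite lift_point_opp// -scaleN1r RP_ofZ// oppr_eq0 oner_eq0.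
Qed.

Lemma realization_flag (R : realType) (n : nat) (D : pred 'I_n.+1)
    (t : 'rV[R]_#|{: lifted_vertex n.+1}|) :
  realization R (flag_complex D) t ->
  exists j S, [/\ D j, flag_avoiding j S &
                  closed_face (@vertex_index n @: S)%SET t].
Proof.
move=> [t0 t1 /flag_complexP[j [S [Dj fS S0 sE]]]]; exists j, S; split => //.
split => // i; rewrite -sE inE negbK => /eqP.
by [].
Qed.

(** The lift picked by [flag_of] may jump, but on each closed face a single lift gives a linear
    formula; the faces are then pasted. *)
Lemma RP_triangulation_continuous (R : realType) (n : nat) (D : pred 'I_n.+1) :
  {within realization R (flag_complex D), continuous (@RP_triangulation R n)}.
Proof.
rewrite realization_closed_face; last exact: flag_complex_simplicial.
apply: within_bigcup_continuous => [|B _|B]; first exact: finite_finset.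
  apply: compact_closed; first exact: norm_hausdorff.
  exact: closed_face_compact.
move=> /= /flag_complexP[j [S [Dj fS S0 ->]]].
apply: (subspace_eq_continuous (f := @RP_of R n \o lift_point S)).
  by move=> t /set_mem tS; exact/esym/(RP_triangulation_lift fS tS).
apply: continuous_in_subspaceT => t /set_mem tS.
apply: continuous_comp; last first.
  by apply: RP_of_continuous; have [] := lift_point_neq0 fS tS.
apply: continuous_rV => k.
rewrite (_ : (fun x => _) = fun x : 'rV[R]_#|{: lifted_vertex n.+1}| =>
  \sum_(a in S) x 0 (vertex_index a) * (2 * vertex_height R a k - 1));
    last first.
  by apply/funext => x; rewrite mxE.
apply: continuous_sumr => a _ x.
apply: (continuousM (s := fun y : 'rV[R]_#|{: lifted_vertex n.+1}| =>
  y 0 (vertex_index a)) (t := cst (2 * vertex_height R a k - 1))).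
  exact: coord_continuous.
exact: cst_continuous.
Qed.

Lemma RP_triangulation_inj (R : realType) (n : nat) (D : pred 'I_n.+1) :
  {in realization R (flag_complex D) &, injective (@RP_triangulation R n)}.
Proof.
move=> t t' /set_mem/realization_flag[j [S [_ fS tS]]].
move=> /set_mem/realization_flag[j' [S' [_ fS' tS']]].
rewrite (RP_triangulation_lift fS tS) (RP_triangulation_lift fS' tS').
have [lj l0] := lift_point_neq0 fS tS;
  have [lj' l'0] := lift_point_neq0 fS' tS'.
have fw := lift_weight_flag fS tS; have fw' := lift_weight_flag fS' tS'.
have w1 : \sum_a lift_weight S t a = 1 by case: fw.
have w'1 : \sum_a lift_weight S' t' a = 1 by case: fw'.
move=> /(RP_of_eq l0 l'0)[c c0 E].
have Ek k : 2 * weight_point (lift_weight S' t') k - 1 =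
            c * (2 * weight_point (lift_weight S t) k - 1).
  by rewrite -!lift_pointE// E mxE.
rewrite -(push_lift_weight fS tS) -(push_lift_weight fS' tS').
have P0 k := weight_point_ge0 k fw; have P1 k := weight_point_le1 k fw.
have P'0 k := weight_point_ge0 k fw'; have P'1 k := weight_point_le1 k fw'.
have z := weight_point_avoided fw; have z' := weight_point_avoided fw'.
(* Both points lie in the cube. Coordinate [j] of the first is -1, hence [c] is at most 1 in
   absolute value; coordinate [j'] of the second is -1, hence it is at least 1. *)
have c2 : c = 1 \/ c = -1.
  have := Ek j; rewrite z => e; have := Ek j'; rewrite z' => e'.
  have := P'0 j; have := P'1 j; have := P0 j'; have := P1 j' => a1 a2 a3 a4.
  have [cp|cn] := leP 0 c; [left | right]; nra.
case: c2 Ek => -> Ek.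
  have ww' : lift_weight S t =1 lift_weight S' t'.
    by apply: (flag_weight_inj fw fw') => k; have := Ek k; lra.
  by apply/rowP => v; rewrite !mxE; apply: eq_bigr => a _; exact: ww'.
(* The points are antipodal, so the first has height 1 at [j'] and its flag can be replaced by the
   opposite one, which reduces to uniqueness of weights. *)
have y1 : weight_point (lift_weight S t) j' = 1 by have := Ek j'; rewrite z';
  lra.
have [fo wo] := flag_weight_opp fw y1.
have ww' : lift_weight S t \o @vertex_opp n.+1 =1 lift_weight S' t'.
  by apply: (flag_weight_inj fo fw') => k; rewrite wo; have := Ek k; lra.
apply/rowP => v; rewrite !mxE.
rewrite (reindex_inj (_ : injective (@vertex_opp n.+1))) /=; last first.
  by apply: (can_inj (g := @vertex_opp n.+1)) => -[C|i] //=;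
    rewrite finset.setCK.
by apply: eq_big => a; [rewrite vertex_index_opp | rewrite -ww'].
Qed.

Lemma RP_triangulation_surj (R : realType) (n : nat) (i : 'I_n.+1)
    (x : 'rV[R]_n.+1) : x != 0 -> (forall k, `|x 0 k| <= `|x 0 i|) ->
  exists2 t, realization R (flag_complex (pred1 i)) t &
             RP_triangulation t = RP_of x.
Proof.
move=> x0 xi.
have xi0 : x 0 i != 0.
  apply: contra_neq x0 => xi0; apply/rowP => k; rewrite mxE; apply/eqP.
  by rewrite -normr_le0 (le_trans (xi k))// xi0 normr0.
(* The representative in the boundary of the cube whose coordinate [i] is -1, hence 0 in heights. *)
pose x' := (- (x 0 i)^-1) *: x.
have x'1 k : `|x' 0 k| <= 1.
  by rewrite mxE normrM normrN normfV ler_pdivrMl ?mulr1 ?normr_gt0.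
have x'i : x' 0 i = -1 by rewrite mxE mulNr mulVf.
have y01 k : 0 <= (1 + x' 0 k) / 2 <= 1.
  by have := x'1 k; rewrite ler_norml; lra.
have yi : (1 + x' 0 i) / 2 = 0 by rewrite x'i subrr mul0r.
have [w fw wE] := flag_weight_exists (j := i) y01 yi.
have [wf ws] := push_weight_face fw; have [w0 w1 fS] := fw.
exists (push_weight w).
  have [t0 t1 _] := wf; split => //; rewrite -/(point_support _) ws.
  apply/flag_complexP; exists i, (weight_support w); split => //.
    exact: eqxx.
  apply/set0Pn; apply/existsP; apply: contra_eqT w1 => /existsPn h.
  rewrite big1 1?eq_sym ?oner_eq0// => a _.
  by have := h a; rewrite inE negbK => /eqP.
rewrite (RP_triangulation_lift fS wf).
have -> : lift_point (weight_support w) (push_weight w) = x'.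
  have wK := push_weightK fw.
  apply/rowP => k; rewrite lift_pointE; last by rewrite (eq_bigr w).
  have -> : weight_point (lift_weight (weight_support w) (push_weight w)) k =
            weight_point w k by apply: eq_bigr => a _; rewrite wK.
  by rewrite wE; lra.
by rewrite RP_ofZ// oppr_eq0 invr_eq0.
Qed.

Lemma max_coord (R : realType) (n : nat) (x : 'rV[R]_n.+1) :
  exists i, forall k, `|x 0 k| <= `|x 0 i|.
Proof.
case: (@arg_maxP _ _ _ ord0 predT (fun k => `|x 0 k|) isT) => i _ h.
by exists i => k; exact: h.
Qed.

Lemma RP_triangulation_homeomorphism (R : realType) (n : nat) :
  triangulation (flag_complex (@predT 'I_n.+1)) (@RP_triangulation R n).
Proof.
have sX := @flag_complex_simplicial n predT; split => //.
have <- : @RP_triangulation R n @` realization R (flag_complex predT) = [set: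
  RP R n].
  apply/seteqP; split=> // q _; have [x x0 ->] := RP_of_surj q.
  have [i xi] := max_coord x;
    have [t [t0 t1 tX] tE] := RP_triangulation_surj x0 xi.
  exists t => //; split => //; apply: fintype.subsetP tX.
  exact: flag_complex_sub.
apply: compact_homeomorphism; first exact: RP_hausdorff.
- exact: realization_compact.
- exact: RP_triangulation_continuous.
- exact: RP_triangulation_inj.
Qed.

(** * The cubical subdivision of the simplex *)

(* With y = t / max t, the cube I_{F <= G} (F, G spanned by A and B) is
   [{t | y = 1 on A, y = 0 off B}]. *)
Definition simplex_cell (R : realType) (n : nat) (A B : {set 'I_n.+1}) :
    set 'rV[R]_n.+1 :=
  [set t | [/\ @std_simplex R n t, forall i, i \in A ->
    forall j, t 0 j <= t 0 i &
               forall j, j \notin B -> t 0 j = 0]].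

Arguments simplex_cell R {n} A B.

Definition simplex_cells (R : realType) (n : nat) : set (set 'rV[R]_n.+1) :=
  [set c | exists A B : {set 'I_n.+1},
    [/\ A != finset.set0, A \subset B & c = simplex_cell R A B]].

Definition normalize_sum (R : realType) (n : nat) (w : 'I_n.+1 -> R) :
    'rV[R]_n.+1 := \row_k (w k / \sum_i w i).

(** The vector [t / max t] in terms of the cube coordinates; dividing by its sum returns to the
    simplex. *)
Definition chart_height (R : realType) (n : nat) (A B : {set 'I_n.+1})
    (y : 'rV[R]_#|(B :\: A)%SET|) (k : 'I_n.+1) : R :=
  (k \in A)%:R + \sum_l (enum_val l == k)%:R * y 0 l.

Definition cell_chart (R : realType) (n : nat) (A B : {set 'I_n.+1})
    (y : 'rV[R]_#|(B :\: A)%SET|) : 'rV[R]_n.+1 :=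
  normalize_sum (chart_height y).

Lemma normalize_sum_simplex (R : realType) (n : nat) (w : 'I_n.+1 -> R) :
  (forall k, 0 <= w k) -> 0 < \sum_i w i -> @std_simplex R n (normalize_sum w).
Proof.
move=> w0 sw; split=> [i|]; first by rewrite mxE divr_ge0// ltW.
under eq_bigr do rewrite mxE.
by rewrite -mulr_suml divff// gt_eqF.
Qed.

Lemma normalize_sum_cell (R : realType) (n : nat) (A B : {set 'I_n.+1})
    (w : 'I_n.+1 -> R) :
  (forall k, 0 <= w k <= 1) -> 0 < \sum_i w i -> (forall k, k \in A ->
    w k = 1) ->
  (forall k, k \notin B -> w k = 0) -> simplex_cell R A B (normalize_sum w).
Proof.
move=> w01 sw wA wB; split; first by apply: normalize_sum_simplex => // k;
  have /andP[] := w01 k.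
  move=> i iA j; rewrite !mxE ler_wpM2r ?invr_ge0 ?(ltW sw)// (wA i)//.
  by have /andP[] := w01 j.
by move=> j jB; rewrite mxE wB// mul0r.
Qed.

Lemma simplex_cell_top (R : realType) (n : nat) (A B : {set 'I_n.+1})
    (t : 'rV[R]_n.+1) (a : 'I_n.+1) :
  simplex_cell R A B t -> a \in A -> 0 < t 0 a.
Proof.
move=> [[t0 t1] tA _] aA; rewrite lt_def t0 andbT; apply/eqP => ta.
move/eqP: t1; rewrite big1 ?(eq_sym 0) ?oner_eq0// => i _; apply/le_anti.
by rewrite t0 -ta tA.
Qed.

Lemma simplex_cell_sub (R : realType) (n : nat) (A B A' B' : {set 'I_n.+1}) :
  A != finset.set0 -> A \subset B ->
  simplex_cell R A B `<=` simplex_cell R A' B' <-> A' \subset A /\ B \subset B'.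
Proof.
move=> /set0Pn[a aA] AB; split=> [sub|[A'A BB'] t [tQ tA tB]]; last first.
  split => // [i iA'|j jB']; first exact/tA/(fintype.subsetP A'A).
  by apply: tB; apply: contra jB'; exact: (fintype.subsetP BB').
(* A relative interior point of the cell: its maximum is attained exactly on [A], and its support is
   exactly [B]. *)
pose w k : R := if k \in A then 1 else if k \in B then 2^-1 else 0.
have w01 k : 0 <= w k <= 1.
  by rewrite /w; case: ifP => _; [|case: ifP => _]; lra.
have sw : 0 < \sum_i w i.
  rewrite (bigD1 a)//= {1}/w aA ltr_pwDl//; apply: sumr_ge0 => i _.
  by have /andP[] := w01 i.
have [|tQ tA' tB'] := sub (normalize_sum w).
  apply: normalize_sum_cell => // k; first by rewrite /w => ->.
  move=> kB; rewrite /w (negbTE kB) ifN//; apply: contra kB.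
  exact: (fintype.subsetP AB).
split; apply/fintype.subsetP => i iP.
  have := tA' i iP a; rewrite !mxE ler_pM2r ?invr_gt0// {1}/w aA /w.
  by case: ifP => // _; case: ifP => _; lra.
apply: contraT => /tB'; rewrite mxE => /eqP;
  rewrite mulf_eq0 invr_eq0 (gt_eqF sw) orbF.
rewrite /w iP; case: ifP => _; first by rewrite oner_eq0.
by rewrite invr_eq0 pnatr_eq0.
Qed.

Lemma simplex_cellI (R : realType) (n : nat) (A B A' B' : {set 'I_n.+1}) :
  simplex_cell R A B `&` simplex_cell R A' B' =
  simplex_cell R (A :|: A')%SET (B :&: B')%SET.
Proof.
apply/seteqP; split=> t.
  case=> -[tQ tA tB] [_ tA' tB']; split => // [i|j].
    by rewrite inE => /orP[iA|iA']; [exact: tA | exact: tA'].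
  by rewrite inE negb_and => /orP[jB|jB']; [exact: tB | exact: tB'].
case=> tQ tA tB; split; split=> //.
- by move=> i iA; apply: tA; rewrite inE iA.
- by move=> j jB; apply: tB; rewrite inE negb_and jB.
- by move=> i iA; apply: tA; rewrite inE iA orbT.
- by move=> j jB; apply: tB; rewrite inE negb_and jB orbT.
Qed.

Lemma simplex_cell_nonempty_sub (R : realType) (n : nat) (A B : {set 'I_n.+1}) :
  simplex_cell R A B !=set0 -> A \subset B.
Proof.
move=> [t tc]; apply/fintype.subsetP => i iA; apply: contraT => iB.
have := simplex_cell_top tc iA; case: tc => _ _ /(_ i iB) ->.
by rewrite ltxx.
Qed.

Lemma chart_height_base (R : realType) (n : nat) (A B : {set 'I_n.+1})
    (y : 'rV[R]_#|(B :\: A)%SET|) (k : 'I_n.+1) :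
  k \in A -> chart_height y k = 1.
Proof.
move=> kA; rewrite /chart_height kA big1 ?addr0// => l _.
have := enum_valP l; rewrite inE => /andP[lA _].
by case: eqP => [e|]; rewrite ?mul0r//; rewrite e kA in lA.
Qed.

Lemma chart_height_free (R : realType) (n : nat) (A B : {set 'I_n.+1})
    (y : 'rV[R]_#|(B :\: A)%SET|) (l : 'I_#|(B :\: A)%SET|) :
  chart_height y (enum_val l) = y 0 l.
Proof.
rewrite /chart_height; have := enum_valP l; rewrite inE => /andP[/negbTE-> _].
rewrite add0r (bigD1 l)//= eqxx mul1r big1 ?addr0// => l' l'l.
by rewrite (inj_eq enum_val_inj) (negbTE l'l) mul0r.
Qed.

Lemma chart_height_out (R : realType) (n : nat) (A B : {set 'I_n.+1})
    (y : 'rV[R]_#|(B :\: A)%SET|) (k : 'I_n.+1) :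
  k \notin A -> k \notin B -> chart_height y k = 0.
Proof.
move=> kA kB; rewrite /chart_height (negbTE kA) add0r big1// => l _.
have := enum_valP l; rewrite inE => /andP[_ lB].
by case: eqP => [e|]; rewrite ?mul0r//; rewrite -e lB in kB.
Qed.

Lemma free_coord (n : nat) (A B : {set 'I_n.+1}) (k : 'I_n.+1) :
  k \in B -> k \notin A -> exists l : 'I_#|(B :\: A)%SET|, k = enum_val l.
Proof.
move=> kB kA; have kD : k \in (B :\: A)%SET by rewrite inE kA.
by exists (enum_rank_in kD k); rewrite enum_rankK_in.
Qed.

Lemma chart_height_ge0le1 (R : realType) (n : nat) (A B : {set 'I_n.+1})
    (y : 'rV[R]_#|(B :\: A)%SET|) (k : 'I_n.+1) :
  @unit_cube R _ y -> 0 <= chart_height y k <= 1.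
Proof.
move=> y01; have [kA|kA] := boolP (k \in A).
  by rewrite chart_height_base// ler01 lexx.
have [kB|kB] := boolP (k \in B); last by rewrite chart_height_out// lexx ler01.
by have [l ->] := free_coord kB kA; rewrite chart_height_free; exact: y01.
Qed.

Lemma chart_height_sum (R : realType) (n : nat) (A B : {set 'I_n.+1})
    (y : 'rV[R]_#|(B :\: A)%SET|) : A != finset.set0 ->
  @unit_cube R _ y -> 0 < \sum_k chart_height y k.
Proof.
move=> /set0Pn[a aA] y01; rewrite (bigD1 a)//= chart_height_base// ltr_pwDl//.
by apply: sumr_ge0 => i _; have /andP[] := chart_height_ge0le1 i y01.
Qed.

Lemma unit_cube_face_sub (R : realType) (d : nat) (s : 'I_d -> option bool) :
  unit_cube_face R s `<=` @unit_cube R d.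
Proof.
move=> y ys i; have := ys i; case: (s i) => [b|//] ->.
by case: b; rewrite lexx ler01.
Qed.

Definition face_tops (n : nat) (A B : {set 'I_n.+1})
    (s : 'I_#|(B :\: A)%SET| -> option bool) : {set 'I_n.+1} :=
  (A :|: [set enum_val l | l in [set l | s l == Some true]])%SET.

Definition face_free (n : nat) (A B : {set 'I_n.+1})
    (s : 'I_#|(B :\: A)%SET| -> option bool) : {set 'I_n.+1} :=
  (B :\: [set enum_val l | l in [set l | s l == Some false]])%SET.

Lemma mem_enum_val_imset (n : nat) (D : {set 'I_n.+1}) (P : {set 'I_#|D|})
    (l : 'I_#|D|) : (enum_val l \in [set enum_val l | l in P]%SET) = (l \in P).
Proof. exact: (mem_imset _ _ enum_val_inj). Qed.

(** Fixing a cube coordinate at 1 adds its index to the maximizers [A], fixing it at 0 removes it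
    from [B]. The chart is inverted by dividing by a maximal coordinate. *)
Lemma cell_chart_face (R : realType) (n : nat) (A B : {set 'I_n.+1})
    (s : 'I_#|(B :\: A)%SET| -> option bool) :
  A != finset.set0 -> A \subset B ->
  @cell_chart R n A B @` unit_cube_face R s =
  simplex_cell R (face_tops s) (face_free s).
Proof.
move=> A0 AB; apply/seteqP; split=> [_ [y ys <-]|t tc].
  have y01 := unit_cube_face_sub ys.
  apply: normalize_sum_cell => [k|||k].
  - exact: chart_height_ge0le1.
  - exact: chart_height_sum.
  - move=> k; rewrite inE => /orP[kA|/imsetP[l]];
      first exact: chart_height_base.
    by rewrite inE => /eqP sl ->; rewrite chart_height_free; have := ys l;
      rewrite sl.
  rewrite inE negb_and negbK => /orP[/imsetP[l]|kB].
    by rewrite inE => /eqP sl ->; rewrite chart_height_free; have := ys l;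
      rewrite sl.
  have kA : k \notin A by apply: contra kB; exact: (fintype.subsetP AB).
  exact: chart_height_out.
have /set0Pn[a aA] := A0.
have aT : a \in face_tops s by rewrite inE aA.
have ta := simplex_cell_top tc aT; have [[t0 t1] tA tB] := tc.
have tmax k : k \in face_tops s -> t 0 k = t 0 a.
  by move=> kT; apply/le_anti; rewrite !tA.
pose y : 'rV[R]_#|(B :\: A)%SET| := \row_l (t 0 (enum_val l) / t 0 a).
have yE k : chart_height y k = t 0 k / t 0 a.
  have [kA|kA] := boolP (k \in A).
    by rewrite chart_height_base// tmax ?divff ?gt_eqF// inE kA.
  have [kB|kB] := boolP (k \in B).
    by have [l ->] := free_coord kB kA; rewrite chart_height_free mxE.
  by rewrite chart_height_out// tB ?mul0r// inE negb_and kB orbT.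
exists y; last first.
  apply/rowP => k; rewrite mxE yE (eq_bigr (fun k => t 0 k / t 0 a))//.
  by rewrite -mulr_suml t1 mul1r invrK divfK// gt_eqF.
move=> l; rewrite mxE; case sl: (s l) => [[]|].
- by rewrite tmax ?divff ?gt_eqF// inE mem_enum_val_imset inE sl eqxx orbT.
- by rewrite tB ?mul0r// inE negb_and mem_enum_val_imset inE sl eqxx.
- by rewrite ler_pdivrMr// mul1r tA// divr_ge0// ltW.
Qed.

Lemma cell_chart_continuous (R : realType) (n : nat) (A B : {set 'I_n.+1}) :
  A != finset.set0 -> {within @unit_cube R _, continuous (@cell_chart R n A B)}.
Proof.
move=> A0; apply: continuous_in_subspaceT => y /set_mem y01.
have ch k : continuous (fun y => @chart_height R n A B y k).
  move=> x; apply: (@continuousD R R _ (cst _) _ x);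
    first exact: cst_continuous.
  apply: continuous_sumr => l _ z.
  apply: (continuousM (s := cst _) (t := fun y : 'rV[R]_#|(B :\: A)%SET| =>
    y 0 l)).
    exact: cst_continuous.
  exact: coord_continuous.
apply: continuous_rV => k.
rewrite (_ : (fun y => _) = (fun y =>
  @chart_height R n A B y k / \sum_i chart_height y i)); last first.
  by apply/funext => z; rewrite mxE.
apply: (continuousM (s := fun y => @chart_height R n A B y k)); first exact: ch.
apply: (@continuousV R _ (fun y => \sum_i @chart_height R n A B y i)).
  by rewrite gt_eqF// chart_height_sum.
by apply: continuous_sumr => i _; exact: ch.
Qed.

Lemma cell_chart_inj (R : realType) (n : nat) (A B : {set 'I_n.+1}) :
  A != finset.set0 -> {in @unit_cube R _ &, injective (@cell_chart R n A B)}.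
Proof.
move=> A0 y y' /set_mem y01 /set_mem y'01 E; have /set0Pn[a aA] := A0.
have sy := chart_height_sum A0 y01; have sy' := chart_height_sum A0 y'01.
have Ek k : chart_height y k / \sum_k chart_height y k =
            chart_height y' k / \sum_k chart_height y' k.
  by have := congr1 (fun t : 'rV[R]_n.+1 => t 0 k) E; rewrite !mxE.
(* Both heights at [a] are 1, so the normalizing sums agree. *)
have := Ek a; rewrite !chart_height_base// !mul1r => /invr_inj ss.
apply/rowP => l; rewrite -!chart_height_free; have := Ek (enum_val l);
  rewrite ss.
by apply: mulIf; rewrite invr_eq0 gt_eqF.
Qed.

Lemma unit_cube_compact (R : realType) (d : nat) : compact (@unit_cube R d).
Proof.
rewrite (_ : @unit_cube R d = [set y : 'rV[R]_d |
  forall i, `[0, 1]%classic (y ord0 i)]).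
  apply: (@rV_compact R d (fun=> `[0, 1]%classic)) => i.
  exact: segment_compact.
by apply/seteqP; split=> y h i; have := h i; rewrite /= ?in_itv.
Qed.

Lemma simplex_cells_cubical (R : realType) (n : nat) :
  cubical_subdivision (@std_simplex R n) (@simplex_cells R n).
Proof.
split.
- rewrite (_ : @simplex_cells R n = (fun p => simplex_cell R p.1 p.2) @`
    [set` [set p : {set 'I_n.+1} * {set 'I_n.+1} |
      (p.1 != finset.set0) && (p.1 \subset p.2)]%SET]).
    exact/finite_image/finite_finset.
  apply/seteqP; split=> c.
    by case=> A [B [A0 AB ->]]; exists (A, B) => //=; rewrite inE /= A0.
  by case=> -[A B] /=; rewrite inE /= => /andP[A0 AB] <-; exists A, B.
- move=> c [A [B [A0 AB ->]]]; exists #|(B :\: A)%SET|, (@cell_chart R n A B).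
  have cT : @cell_chart R n A B @` @unit_cube R _ = simplex_cell R A B.
    rewrite /unit_cube cell_chart_face//; congr simplex_cell.
      apply/setP => i; rewrite inE; case: imsetP => [[l]|_];
        last by rewrite orbF.
      by rewrite inE.
    apply/setP => i; rewrite inE; case: imsetP => [[l]|_ //].
    by rewrite inE.
  split.
    rewrite -cT; apply: compact_homeomorphism; first exact: norm_hausdorff.
    - exact: unit_cube_compact.
    - exact: cell_chart_continuous.
    - exact: cell_chart_inj.
  move=> c'; split=> [[[A' [B' [A'0 A'B' ->]]]]|[s ->]].
    move=> /(simplex_cell_sub R A B A'0 A'B')[AA' B'B].
    exists (fun l => if enum_val l \in A' then Some true
                     else if enum_val l \in B' then None else Some false).
    rewrite cell_chart_face//; congr simplex_cell; apply/setP => i; rewrite inE.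
      apply/idP/orP => [iA'|[/(fintype.subsetP AA')//|/imsetP[l]]]; last first.
        by rewrite inE; case: ifP => [lA' _ ->//|_]; case: ifP.
      have [iA|iA] := boolP (i \in A); [by left|right].
      have iB : i \in B by apply: (fintype.subsetP B'B);
        exact: (fintype.subsetP A'B').
      have [l lE] := free_coord iB iA;
        rewrite lE mem_enum_val_imset inE -lE iA'.
      by [].
    apply/idP/andP => [iB'|[il iB]].
      split; last exact: (fintype.subsetP B'B).
      apply/imsetP => -[l]; rewrite inE => + iE; rewrite -iE iB'.
      by case: ifP.
    have [iA|iA] := boolP (i \in A).
      by apply: (fintype.subsetP A'B'); exact: (fintype.subsetP AA').
    have [l lE] := free_coord iB iA; move: il;
      rewrite lE mem_enum_val_imset inE -lE.
    case: ifP => [iA' _|_]; first exact: (fintype.subsetP A'B').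
    by case: ifP.
  rewrite cell_chart_face//; set A' := face_tops s; set B' := face_free s.
  have A'0 : A' != finset.set0.
    by have /set0Pn[a aA] := A0; apply/set0Pn; exists a; rewrite inE aA.
  have A'B' : A' \subset B'.
    apply/fintype.subsetP => i; rewrite !inE => /orP[iA|/imsetP[l]].
      rewrite (fintype.subsetP AB)// andbT; apply/imsetP => -[l _ lE].
      by have := enum_valP l; rewrite -lE inE iA.
    rewrite inE => /eqP sl ->; rewrite mem_enum_val_imset inE sl /=.
    by have := enum_valP l; rewrite inE => /andP[].
  split; first by exists A', B'.
  apply/simplex_cell_sub => //; split; first exact: finset.subsetUl.
  exact: finset.subsetDl.
- move=> c c' [A [B [A0 AB ->]]] [A' [B' [A'0 A'B' ->]]]; rewrite simplex_cellI.
  move=> /simplex_cell_nonempty_sub h; exists (A :|: A')%SET, (B :&: B')%SET.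
  split => //; have /set0Pn[a aA] := A0; apply/set0Pn; exists a.
  by rewrite inE aA.
- apply/seteqP; split=> [t [c [A [B [A0 AB ->]]] []]//|t tQ].
  case: (@arg_maxP _ _ _ ord0 predT (fun k => t 0 k) isT) => a _ amax.
  exists (simplex_cell R [set a]%SET [set: 'I_n.+1]%SET).
    exists [set a]%SET, [set: 'I_n.+1]%SET; split => //; first by apply/set0Pn;
      exists a; rewrite inE.
  split=> // [i|j]; last by rewrite inE.
  by rewrite inE => /eqP-> j; exact: amax.
- move=> F [[x0 Fx0] [a FE]].
  (* A face is determined by supports. Testing the functional at the vertices bounds its
     coefficients by its maximum [M]; since the average of [M - a 0 i] with weights [x] is 0, the
     coefficients equal [M] on the support of [x], hence on that of [y]. *)
  have supF x y : F x -> @std_simplex R n y -> (forall k, x 0 k = 0 ->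
    y 0 k = 0) -> F y.
    rewrite FE => -[[x_0 x1] xmax] yQ yx; split => // z zQ.
    have vQ k : a 0 k <= \sum_i a 0 i * x 0 i.
      have dQ : @std_simplex R n (delta_mx 0 k).
        split=> [i|]; first by rewrite mxE ler0n.
        rewrite (bigD1 k)//= mxE !eqxx big1 ?addr0// => i /negbTE ik.
        by rewrite mxE eqxx ik.
      have := xmax _ dQ;
        rewrite (bigD1 k)//= mxE !eqxx mulr1 big1 ?addr0// => i /negbTE ik.
      by rewrite mxE eqxx ik mulr0.
    apply: le_trans (xmax z zQ) _; set M := \sum_i a 0 i * x 0 i in vQ *.
    have sM : \sum_i (M - a 0 i) * x 0 i = 0.
      under eq_bigr do rewrite mulrBl.
      by rewrite sumrB -mulr_sumr x1 mulr1 subrr.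
    have zM i : (M - a 0 i) * x 0 i = 0.
      move/eqP: sM; rewrite psumr_eq0 => [/allP/(_ i)|j _].
        by rewrite mem_index_enum => /(_ isT)/eqP.
      by rewrite mulr_ge0// subr_ge0.
    case: yQ => y_0 y1.
    rewrite -[M]mulr1 -y1 mulr_sumr; apply: ler_sum => i _.
    have /eqP := zM i; rewrite mulf_eq0 subr_eq0 => /orP[/eqP->//|/eqP/yx->].
    by rewrite !mulr0.
  apply/seteqP; split=> [x Fx|x [c [_ cF] cx]]; last exact: cF.
  have xQ : @std_simplex R n x by move: Fx; rewrite FE => -[].
  case: (@arg_maxP _ _ _ ord0 predT (fun k => x 0 k) isT) => i _ imax.
  (* The cell spanned by one maximal coordinate and the support of [x] contains [x] and, by [supF],
     stays in the face. *)
  pose B := [set k | x 0%R k != 0%R]%SET.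
  have cx : simplex_cell R [set i]%SET B x.
    split=> // [k|k]; last by rewrite inE negbK => /eqP.
    by rewrite inE => /eqP-> j; exact: imax.
  exists (simplex_cell R [set i]%SET B) => //; split.
    exists [set i]%SET, B; split => //; first by apply/set0Pn; exists i;
      rewrite inE.
    by apply: simplex_cell_nonempty_sub; exists x.
  move=> y [yQ _ yB]; apply: supF Fx yQ _ => k xk.
  by apply: yB; rewrite inE xk eqxx.
Qed.

(** By [simplex_cell_sub] a cell grows when [A] shrinks and [B] grows, so a maximal one has a single
    maximizer and the full [B]. *)
Lemma simplex_cell_maximal (R : realType) (n : nat) (c : set 'rV[R]_n.+1) :
  maximal_cube (@simplex_cells R n) c <->
  exists i : 'I_n.+1, c = simplex_cell R [set i]%SET [set: 'I_n.+1]%SET.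
Proof.
have sC i : @simplex_cells R n (simplex_cell R [set i]%SET [set: 'I_n.+1]%SET).
  exists [set i]%SET, [set: 'I_n.+1]%SET; split => //; first by apply/set0Pn;
    exists i; rewrite inE.
split=> [[[A [B [A0 AB ->]]] cmax]|[i ->]].
  have /set0Pn[i iA] := A0; exists i; apply/esym/cmax => //.
  by apply/simplex_cell_sub => //; rewrite finset.sub1set finset.subsetT.
split => // c' [A [B [A0 AB ->]]] /simplex_cell_sub.
case=> [||]; first by apply/set0Pn; exists i; rewrite inE.
  exact: finset.subsetT.
rewrite subset1 (negbTE A0) orbF finset.subTset => /eqP-> /eqP->.
by [].
Qed.

(** * Zones of influence *)

(** The preimage of the maximal cube at the [i]-th vertex: the lines whose [i]-th homogeneous
    coordinate is largest in absolute value, i.e. the image of a pair of opposite facets. *)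
Definition RP_zone (R : realType) (n : nat) (i : 'I_n.+1) : set (RP R n) :=
  [set q | forall j, RP_orbit_map q 0 j <= RP_orbit_map q 0 i].
Arguments RP_zone R {n} i.

Definition euclidean_norm (R : realType) (n : nat) (z : 'rV[R]_n) : R :=
  Num.sqrt (\sum_j z 0 j ^+ 2).

Definition ball_height (R : realType) (n : nat) (z : 'rV[R]_n) : R :=
  `|z| + 1 - euclidean_norm z.

(* On a ray, |z_j| / (`|z| + 1 - |z|_2) increases from 0 at the center to
   |z_j| / `|z| on the unit sphere, so the ratios to the i-th coordinate map the
   Euclidean ball onto the cube. *)
Definition ball_param (R : realType) (n : nat) (i : 'I_n.+1) (z : 'rV[R]_n) :
    'rV[R]_n.+1 :=
  \row_k (if unlift i k is Some j then z 0 j else ball_height z).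

Lemma RP_zone_of (R : realType) (n : nat) (i : 'I_n.+1) (x : 'rV[R]_n.+1) :
  x != 0 -> RP_zone R i (RP_of x) <-> forall k, `|x 0 k| <= `|x 0 i|.
Proof.
move=> x0; rewrite /RP_zone /= RP_orbit_map_of//; have s0 := sum_sqr_gt0 x0.
suff E k : (orbit_coordinates x 0 k <= orbit_coordinates x 0 i) =
           (`|x 0 k| <= `|x 0 i|).
  by split=> h k; [rewrite -E | rewrite E].
rewrite !mxE ler_pM2r ?invr_gt0// -real_normK ?num_real//.
by rewrite -[in leRHS]real_normK ?num_real// ler_pXn2r// nnegrE.
Qed.

Lemma RP_zone_closed (R : realType) (n : nat) (i : 'I_n.+1) :
  closed (RP_zone R i).
Proof.
rewrite (_ : RP_zone R i = \bigcap_(j in setT)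
  [set q : RP R n | 0 <= RP_orbit_map q 0 i - RP_orbit_map q 0 j]); last first.
  apply/seteqP; split=> q h j; first by move=> _ /=; rewrite subr_ge0; exact: h.
  by rewrite -subr_ge0; exact: h.
apply: closed_bigI => j _.
apply: (@preimage_closed _ _ (fun q : RP R n =>
  RP_orbit_map q 0 i - RP_orbit_map q 0 j)
  [set x | 0 <= x]); last exact: closed_ge.
move=> q _; apply: (@continuousB R R _ (fun q : RP R n => RP_orbit_map q 0 i)
  (fun q : RP R n => RP_orbit_map q 0 j)); exact: RP_orbit_map_continuous.
Qed.

Lemma RP_orbit_map_zone (R : realType) (n : nat) (i : 'I_n.+1) :
  @RP_orbit_map R n @` RP_zone R i =
  simplex_cell R [set i]%SET [set: 'I_n.+1]%SET.
Proof.
apply/seteqP; split=> [_ [q qi <-]|t [tQ ti _]].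
  split=> [|k|j]; last by rewrite inE.
    by rewrite -RP_orbit_map_image; exists q.
  by rewrite inE => /eqP-> j; exact: qi.
move: (tQ); rewrite -RP_orbit_map_image => -[q _ qE]; exists q => // j.
by rewrite qE; apply: ti; rewrite inE.
Qed.

Lemma euclidean_norm_ge0 (R : realType) (n : nat) (z : 'rV[R]_n) :
  0 <= euclidean_norm z.
Proof. exact: sqrtr_ge0. Qed.

Lemma euclidean_normZ (R : realType) (n : nat) (c : R) (z : 'rV[R]_n) :
  0 <= c -> euclidean_norm (c *: z) = c * euclidean_norm z.
Proof.
move=> c0; rewrite /euclidean_norm; under eq_bigr do rewrite mxE exprMn.
by rewrite -mulr_sumr sqrtrM ?sqr_ge0// sqrtr_sqr ger0_norm.
Qed.

Lemma coord_le_norm (R : realType) (n : nat) (z : 'rV[R]_n) (j : 'I_n) :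
  `|z 0 j| <= `|z|.
Proof.
rewrite -[leRHS]/(mx_norm z) mx_normrE.
exact: (le_bigmax _ (fun k : 'I_1 * 'I_n => `|z k.1 k.2|) (0, j)).
Qed.

Lemma norm_le_coord (R : realType) (n : nat) (z : 'rV[R]_n) (c : R) :
  0 <= c -> (forall j, `|z 0 j| <= c) -> `|z| <= c.
Proof.
move=> c0 zc; rewrite -[leLHS]/(mx_norm z) mx_normrE.
by apply: bigmax_le => // -[a j] _ /=; rewrite (ord1 a).
Qed.

Lemma mem_euclidean_ball (R : realType) (n : nat) (z : 'rV[R]_n) :
  euclidean_closed_ball 0 1 z <-> euclidean_norm z <= 1.
Proof.
rewrite /euclidean_closed_ball /= expr1n.
under eq_bigr do rewrite mxE subr0.
rewrite /euclidean_norm -[X in _ <-> _ <= X]sqrtr1 ler_psqrt ?nnegrE//.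
by apply: sumr_ge0 => j _; exact: sqr_ge0.
Qed.

Lemma ball_height_gt0 (R : realType) (n : nat) (z : 'rV[R]_n) :
  euclidean_norm z <= 1 -> 0 < ball_height z /\ `|z| <= ball_height z.
Proof.
move=> z1; rewrite /ball_height; split; last lra.
have [->|z0] := eqVneq z 0.
  have -> : euclidean_norm (0 : 'rV[R]_n) = 0.
    by rewrite /euclidean_norm big1 ?sqrtr0// => j _; rewrite mxE expr0n.
  by rewrite normr0 add0r subr0.
have : 0 < `|z| by rewrite normr_gt0.
lra.
Qed.

Lemma ball_heightZ (R : realType) (n : nat) (c : R) (z : 'rV[R]_n) :
  0 <= c -> ball_height (c *: z) = c * (`|z| - euclidean_norm z) + 1.
Proof.
by move=> c0; rewrite /ball_height normrZ euclidean_normZ// ger0_norm//; ring.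
Qed.

Lemma ball_param_top (R : realType) (n : nat) (i : 'I_n.+1) (z : 'rV[R]_n) :
  ball_param i z 0 i = ball_height z.
Proof. by rewrite mxE unlift_none. Qed.

Lemma ball_param_lift (R : realType) (n : nat) (i : 'I_n.+1) (z : 'rV[R]_n)
    (j : 'I_n) : ball_param i z 0 (lift i j) = z 0 j.
Proof. by rewrite mxE liftK. Qed.

Lemma ball_param_neq0 (R : realType) (n : nat) (i : 'I_n.+1) (z : 'rV[R]_n) :
  euclidean_norm z <= 1 -> ball_param i z != 0.
Proof.
move=> /ball_height_gt0[N0 _]; apply: contraTneq N0 => z0.
by rewrite -(ball_param_top i) z0 mxE ltxx.
Qed.

Lemma ball_param_image (R : realType) (n : nat) (i : 'I_n.+1) :
  (@RP_of R n \o ball_param i) @` euclidean_closed_ball 0 1 = RP_zone R i.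
Proof.
apply/seteqP; split=> [_ [z /mem_euclidean_ball z1 <-]|q].
  have [N0 zN] := ball_height_gt0 z1.
  apply/RP_zone_of => [|k]; first exact: ball_param_neq0.
  rewrite ball_param_top [leRHS]gtr0_norm//; case: (unliftP i k) => [j|] ->.
    by rewrite ball_param_lift (le_trans (coord_le_norm _ _)).
  by rewrite ball_param_top gtr0_norm.
have [x x0 ->] := RP_of_surj q => /RP_zone_of-/(_ x0) xi.
have xi0 : x 0 i != 0.
  apply: contra_neq x0 => xi0; apply/rowP => k; rewrite mxE; apply/eqP.
  by rewrite -normr_le0 (le_trans (xi k))// xi0 normr0.
pose y : 'rV[R]_n := \row_j (x 0 (lift i j) / x 0 i).
have y1 : `|y| <= 1.
  apply: norm_le_coord => // j.
  by rewrite mxE normrM normfV ler_pdivrMr ?mul1r ?normr_gt0.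
have e0 := euclidean_norm_ge0 y.
(* The solution of [ball_height (s *: y) = s], which makes the parametrized point proportional to
   [x]. That [s *: y] lies in the ball amounts to the sup norm of [y] being at most 1. *)
pose s := (1 - `|y| + euclidean_norm y)^-1.
have d0 : 0 < 1 - `|y| + euclidean_norm y.
  have [y0|y0] := eqVneq (euclidean_norm y) 0; last first.
    have : 0 < euclidean_norm y by rewrite lt_def y0.
    lra.
  have -> : y = 0.
    apply/rowP => j; rewrite [RHS]mxE; apply/eqP.
    move/eqP: y0; rewrite /euclidean_norm sqrtr_eq0 => le0.
    rewrite -sqrf_eq0; apply/eqP/le_anti; rewrite sqr_ge0 andbT.
    apply: le_trans le0; rewrite (bigD1 j)//= lerDl.
    by apply: sumr_ge0 => k _; exact: sqr_ge0.
  by rewrite normr0 subr0; have := euclidean_norm_ge0 (0 : 'rV[R]_n); lra.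
have s0 : 0 < s by rewrite invr_gt0.
have sd : s * (1 - `|y| + euclidean_norm y) = 1 by rewrite mulVf ?gt_eqF.
have Ns : ball_height (s *: y) = s.
  by rewrite ball_heightZ ?ltW//; move: sd; set a := `|y|;
    set b := euclidean_norm y; lra.
exists (s *: y).
  apply/mem_euclidean_ball; rewrite euclidean_normZ ?(ltW s0)//.
  rewrite -[leRHS]sd ler_pM2l//; lra.
rewrite /=; have -> : ball_param i (s *: y) = (s / x 0 i) *: x.
  apply/rowP => k; rewrite [RHS]mxE; case: (unliftP i k) => [j|] ->.
    by rewrite ball_param_lift !mxE mulrA mulrAC.
  by rewrite ball_param_top Ns divfK.
by rewrite RP_ofZ// mulf_neq0 ?invr_eq0// gt_eqF.
Qed.

Lemma ball_param_inj (R : realType) (n : nat) (i : 'I_n.+1) :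
  {in euclidean_closed_ball 0 1 &, injective (@RP_of R n \o ball_param i)}.
Proof.
move=> z z' /set_mem/mem_euclidean_ball z1 /set_mem/mem_euclidean_ball z'1 /=.
have [N0 _] := ball_height_gt0 z1; have [N'0 _] := ball_height_gt0 z'1.
move=> /(RP_of_eq (ball_param_neq0 i z1) (ball_param_neq0 i z'1))[c c0 E].
have E' k : ball_param i z' 0 k = c * ball_param i z 0 k by rewrite E mxE.
have zE : z' = c *: z.
  by apply/rowP => j; have := E' (lift i j); rewrite !ball_param_lift mxE.
have := E' i; rewrite !ball_param_top => NE.
(* Both heights are positive, so [c] is; along a ray the height is affine with constant term 1, and
   it is scaled by [c] only if [c = 1]. *)
have cp : 0 < c by rewrite -(pmulr_lgt0 _ N0) -NE.
have : c = 1.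
  move: NE; rewrite zE ball_heightZ ?ltW// /ball_height.
  by set a := `|z|; set b := euclidean_norm z; lra.
by move=> c1; rewrite zE c1 scale1r.
Qed.

Lemma ball_param_continuous (R : realType) (n : nat) (i : 'I_n.+1) :
  {within euclidean_closed_ball 0 1, continuous (@RP_of R n \o ball_param i)}.
Proof.
apply: continuous_in_subspaceT => z /set_mem/mem_euclidean_ball z1.
apply: continuous_comp; last exact/RP_of_continuous/ball_param_neq0.
apply: continuous_rV => k; case: (unliftP i k) => [j|] ->.
  rewrite (_ : (fun y => _) = fun y : 'rV[R]_n => y 0 j).
    exact: coord_continuous.
  by apply/funext => y; rewrite ball_param_lift.
rewrite (_ : (fun y => _) = @ball_height R n); last first.
  by apply/funext => y; rewrite ball_param_top.
apply: (@continuousB R R _ (fun y : 'rV[R]_n =>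
  `|y| + 1) (@euclidean_norm R n)).
  apply: (@continuousD R R _ (fun y : 'rV[R]_n => `|y|) (cst 1));
    last exact: cst_continuous.
  exact: norm_continuous.
apply: (continuous_comp (f := fun y : 'rV[R]_n => \sum_j y 0 j ^+ 2)).
  apply: continuous_sumr => j _ y.
  by apply: (continuousM (s := fun y : 'rV[R]_n => y 0 j));
    exact: coord_continuous.
exact: sqrt_continuous.
Qed.

Lemma euclidean_ball_compact (R : realType) (n : nat) :
  compact (euclidean_closed_ball 0 1 : set 'rV[R]_n).
Proof.
apply: (@subclosed_compact _ _ [set z : 'rV[R]_n |
  forall i, `[-1, 1]%classic (z ord0 i)]).
- apply: (@preimage_closed _ _ (fun z : 'rV[R]_n =>
    \sum_j (z 0 j - (0 : 'rV[R]_n) 0 j) ^+ 2)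
    [set x | x <= 1 ^+ 2]); last exact: closed_le.
  have cB j : continuous (fun z : 'rV[R]_n => z 0 j - (0 : 'rV[R]_n) 0 j).
    move=> z; apply: (@continuousB R R _ (fun z : 'rV[R]_n => z 0 j) (cst _)).
      exact: coord_continuous.
    exact: cst_continuous.
  move=> z _; apply: continuous_sumr => j _ y.
  by apply: (continuousM (s := fun z : 'rV[R]_n =>
    z 0 j - (0 : 'rV[R]_n) 0 j)); exact: cB.
- apply: (@rV_compact R n (fun=> `[-1, 1]%classic)) => i.
  exact: segment_compact.
move=> z /mem_euclidean_ball z1 i /=; rewrite in_itv /= -ler_norml.
rewrite -sqrtr_sqr (le_trans _ z1)// /euclidean_norm ler_wsqrtr//.
by rewrite (bigD1 i)//= lerDl; apply: sumr_ge0 => k _; exact: sqr_ge0.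
Qed.

(** * Equivariance of the zone charts *)

Definition sign_exponent (n : nat) (g : 'rV['F_2]_n) (k : 'I_n.+1) : 'F_2 :=
  if unlift ord0 k is Some j then g 0 j else 0.

(** The action read in the chart of zone [i]: the ratio of coordinates [k] and [i] changes sign
    according to the sum of both exponents, where the exponent at [ord0] is 0. *)
Definition zone_twist (n : nat) (i : 'I_n.+1) (g : 'rV['F_2]_n) : 'rV['F_2]_n :=
  \row_j (sign_exponent g (lift i j) + sign_exponent g i).

Lemma sign_exponentB (n : nat) (g h : 'rV['F_2]_n) (k : 'I_n.+1) :
  sign_exponent (g - h) k = sign_exponent g k - sign_exponent h k.
Proof. by rewrite /sign_exponent; case: unliftP => [j|] _;
  rewrite ?mxE ?subr0. Qed.

Lemma zone_twist_is_zmod_morphism (n : nat) (i : 'I_n.+1) :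
  zmod_morphism (zone_twist i).
Proof.
move=> g h; apply/rowP => j; rewrite !mxE !sign_exponentB.
by rewrite opprD addrACA.
Qed.

HB.instance Definition _ (n : nat) (i : 'I_n.+1) :=
  GRing.isZmodMorphism.Build _ _ (zone_twist i) (@zone_twist_is_zmod_morphism n
    i).

(** On the kernel all exponents equal the one at [i], hence the one at [ord0], which is 0.
    Injectivity suffices because the group is finite. *)
Lemma zone_twist_bij (n : nat) (i : 'I_n.+1) : bijective (zone_twist i).
Proof.
apply: injF_bij => g h /eqP; rewrite -subr_eq0 -zone_twist_is_zmod_morphism.
move=> /eqP/rowP tw; apply/eqP; rewrite -subr_eq0; apply/eqP.
move: (g - h) tw => {g h} g tw.
have all_eq k : sign_exponent g k = sign_exponent g i.
  case: (unliftP i k) => [j|] -> //; have := tw j; rewrite !mxE => /eqP.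
  by rewrite addr_eq0 oppr_pchar2 ?pchar_Fp// => /eqP.
apply/rowP => j; rewrite mxE.
have : sign_exponent g (lift ord0 j) = sign_exponent g ord0 by rewrite !all_eq.
by rewrite /sign_exponent liftK unlift_none.
Qed.

Lemma signr_F2D (R : realType) (a b : 'F_2) :
  (-1) ^+ (a + b)%R = (-1) ^+ a * (-1) ^+ b :> R.
Proof.
case: a b => [[|[|//]] a2] [[|[|//]] b2];
  rewrite /= ?expr0 ?expr1 ?mul1r ?mulr1//.
by rewrite mulrNN mulr1.
Qed.

Lemma ball_height_sign (R : realType) (n : nat) (g : 'rV['F_2]_n) (z :
  'rV[R]_n) :
  ball_height (sign_act g z) = ball_height z.
Proof.
have nE j : `|sign_act g z 0 j| = `|z 0 j|
  by rewrite mxE normrM normr_sign mul1r.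
rewrite /ball_height /euclidean_norm; congr (_ + _ - _).
  by apply/le_anti/andP; split; apply: norm_le_coord => // j;
    [rewrite nE | rewrite -nE]; exact: coord_le_norm.
congr Num.sqrt; apply: eq_bigr => j _.
by rewrite -real_normK ?num_real// nE real_normK ?num_real.
Qed.

Lemma ball_param_equivariant (R : realType) (n : nat) (i : 'I_n.+1)
    (g : 'rV['F_2]_n) (z : 'rV[R]_n) :
  lift_sign_act g (ball_param i z) =
  (-1) ^+ (sign_exponent g i) *: ball_param i (sign_act (zone_twist i g) z).
Proof.
apply/rowP => k; rewrite lift_sign_actE [RHS]mxE.
have -> : (if unlift ord0 k is Some j then (-1) ^+ (g 0 j) else 1) =
          (-1) ^+ (sign_exponent g k) :> R.
  by rewrite /sign_exponent; case: unliftP => [j|] _.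
case: (unliftP i k) => [j|] ->.
  rewrite !ball_param_lift !mxE signr_F2D.
  by rewrite mulrA mulrCA -expr2 sqrr_sign mulr1.
by rewrite !ball_param_top ball_height_sign.
Qed.

Lemma sign_act_ball (R : realType) (n : nat) :
  Defs.invariant (@sign_act R n) (euclidean_closed_ball 0 1).
Proof.
move=> g x; rewrite /euclidean_closed_ball /=.
congr (_ <= _); apply: eq_bigr => i _; rewrite !mxE !subr0.
by rewrite exprMn sqrr_sign mul1r.
Qed.

Lemma RP_zone_of_influence (R : realType) (n : nat) (i : 'I_n.+1) :
  zone_of_influence (@RP_act R n) (@RP_orbit_map R n) (simplex_center R n)
    (RP_zone R i).
Proof.
have actE g q : RP_orbit_map (RP_act g q) = RP_orbit_map q :> 'rV[R]_n.+1.
  by apply/esym/RP_orbit_map_fiber; exists g.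
split; first exact: RP_zone_closed.
- by move=> g q qi j; rewrite actE; exact: qi.
- by move=> q /= qE j; rewrite qE !mxE.
have [f hf fK] := compact_homeomorphism_inv (@RP_hausdorff R n)
  (@euclidean_ball_compact R n) (@ball_param_continuous R n i)
  (@ball_param_inj R n i).
exists 0, 1, f, (zone_twist i); split => //.
- exact: sign_act_ball.
- by rewrite -ball_param_image.
- exact: zone_twist_bij.
(* As [f] inverts the parametrization, equivariance is checked on the ball, where the common sign
   disappears in projective space. *)
move=> g q; rewrite -ball_param_image => -[z zb <-].
have z1 := (mem_euclidean_ball z).1 zb.
have gb := sign_act_ball (zone_twist i g) zb.
have g1 := (mem_euclidean_ball _).1 gb.
rewrite fK ?inE//= RP_act_of ?ball_param_neq0// ball_param_equivariant.
rewrite RP_ofZ ?signr_eq0 ?ball_param_neq0//.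
by rewrite -[LHS]/(f ((@RP_of R n \o ball_param i) _)) fK ?inE.
Qed.

Lemma RP_zones_complete (R : realType) (n : nat) :
  complete_zones (@RP_act R n) (@std_simplex R n) (@RP_orbit_map R n)
    (simplex_center R n) (@RP_zone R n).
Proof.
split; first exact: RP_zone_of_influence.
exists (@simplex_cells R n); split.
- exact: simplex_cells_cubical.
(* The intersection of the maximal cubes at the vertices in [J] consists of the points whose maximum
   is attained on all of [J]. *)
- move=> J J0; exists J, [set: 'I_n.+1]%SET; split => //.
  apply/seteqP; split=> [t tJ|t [tQ tJ _] j jJ]; last first.
    rewrite RP_orbit_map_zone; split=> // [k|k]; last by rewrite inE.
    by rewrite inE => /eqP->; exact: tJ.
  have /set0Pn[a aJ] := J0; have := tJ a aJ.
  rewrite RP_orbit_map_zone => -[tQ _ _]; split=> // [j jJ|j];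
    last by rewrite inE.
  have := tJ j jJ; rewrite RP_orbit_map_zone => -[_ h _]; apply: h.
  by rewrite inE.
- move=> c; split=> [/simplex_cell_maximal[i ->]|[i ->]]; first by exists i;
    rewrite RP_orbit_map_zone.
  by apply/simplex_cell_maximal; exists i; rewrite RP_orbit_map_zone.
Qed.

(** * Zones and equilibrium set as subcomplexes *)

(** Flags avoiding [i] fill the facet where coordinate [i] is -1, and the opposite facet has the
    same image in projective space. *)
Lemma RP_zone_triangulated (R : realType) (n : nat) (i : 'I_n.+1) :
  triangulated (flag_complex (@predT 'I_n.+1)) (@RP_triangulation R n)
    (RP_zone R i).
Proof.
exists (flag_complex (pred1 i)); split.
- exact: flag_complex_simplicial.
- exact: flag_complex_sub.
apply/seteqP; split=> [_ [t + <-]|q].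
  move=> /realization_flag[j [S [/eqP-> fS tS]]].
  have [li l0] := lift_point_neq0 fS tS.
  rewrite (RP_triangulation_lift fS tS); apply/RP_zone_of => // k.
  have fw := lift_weight_flag fS tS; rewrite li normrN1 lift_pointE;
    last by case: fw.
  have := weight_point_ge0 k fw; have := weight_point_le1 k fw.
  by rewrite ler_norml; lra.
have [x x0 ->] := RP_of_surj q => /RP_zone_of-/(_ x0) xi.
by have [t tX tE] := RP_triangulation_surj x0 xi; exists t.
Qed.

Lemma equilibrium_triangulated (R : realType) (n : nat) :
  triangulated (flag_complex (@predT 'I_n.+2)) (@RP_triangulation R n.+1)
    (equilibrium_set (@RP_orbit_map R n.+1) (simplex_center R n.+1)).
Proof.
exists (corner_complex n.+1); split.
- exact: corner_complex_simplicial.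
- exact: corner_complex_sub.
have cornerP (C : {set 'I_n.+2}) : C != [set: 'I_n.+2]%SET ->
    exists j, flag_avoiding j [set inl C]%SET.
  move=> CT; have [|j jC] := @avoids_exists n (inl C).
    by apply: contra CT => /eqP[->].
  by exists j; rewrite flag_avoiding1.
apply/seteqP; split=> [_ [t [t0 t1 /imsetP[C CT sE]] <-]|q /= qE].
  move: CT; rewrite inE => /cornerP[j fC].
  have tC : closed_face (@vertex_index n.+1 @: [set inl C])%SET t.
    by split=> // i; rewrite imset_set1 -sE inE negbK => /eqP.
  have [_ l0] := lift_point_neq0 fC tC.
  rewrite /equilibrium_set /= (RP_triangulation_lift fC tC) RP_orbit_map_of//.
  have tv : t 0 (vertex_index (inl C)) = 1.
    rewrite -t1 (bigD1 (vertex_index (inl C)))//= big1 ?addr0// => i iC.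
    by case: tC => _ _; apply; rewrite imset_set1 inE.
  have lE k : lift_point [set inl C]%SET t 0 k ^+ 2 = 1.
    rewrite mxE big_set1 tv /=; case: (k \in C) => /=; ring.
  apply/rowP => k; rewrite [LHS]mxE [RHS]mxE lE; under eq_bigr do rewrite lE.
  by rewrite sumr_const card_ord mul1r.
have [x x0 xE] := RP_of_surj q; move: qE.
rewrite /equilibrium_set /= xE RP_orbit_map_of// => qE.
have s0 := sum_sqr_gt0 x0; set s := \sum_j _ in s0.
have sqE k : x 0 k ^+ 2 = x 0 ord0 ^+ 2.
  have := congr1 (fun y : 'rV[R]_n.+2 => y 0 k) qE.
  have := congr1 (fun y : 'rV[R]_n.+2 => y 0 ord0) qE.
  rewrite !mxE -/s => <- /(divIf (_ : s != 0)) -> //; by rewrite gt_eqF.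
(* All coordinates have equal absolute value, so [x] is [c] times a corner. The sign of [c] keeps
   [ord0] out of the set [C] of that corner, hence [C] is not full. *)
pose c := - x 0 ord0.
have c0 : c != 0.
  rewrite oppr_eq0; apply: contra_neq x0 => z; apply/rowP => k; rewrite mxE.
  by apply/eqP; rewrite -sqrf_eq0 sqE z expr0n.
have xc k : x 0 k = c \/ x 0 k = - c.
  have /eqP := sqE k; rewrite eqf_sqr /c opprK => /orP[]/eqP; tauto.
pose C := [set k | x 0%R k == c]%SET.
have CT : C != [set: 'I_n.+2]%SET.
  apply/eqP => /setP/(_ ord0); rewrite !inE /c -subr_eq0 opprK -mulr2n.
  by rewrite mulrn_eq0 /= -oppr_eq0 (negbTE c0).
pose t : 'rV[R]_#|{: lifted_vertex n.+2}| := delta_mx 0 (vertex_index (inl C)).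
have tE v : t 0 v = (v == vertex_index (inl C))%:R by rewrite mxE eqxx.
have t1 : \sum_v t 0 v = 1.
  rewrite (bigD1 (vertex_index (inl C)))//= tE eqxx big1 ?addr0// =>
    v /negbTE vC.
  by rewrite tE vC.
have [j fC] := cornerP C CT.
have tC : closed_face (@vertex_index n.+1 @: [set inl C])%SET t.
  split=> // v; first by rewrite tE ler0n.
  by rewrite imset_set1 inE tE => /negbTE->.
exists t.
  split=> [v||] //; first by rewrite tE ler0n.
  rewrite -/(point_support t).
  have -> : point_support t = [set vertex_index (inl C)]%SET.
    by apply/setP => v; rewrite !inE tE pnatr_eq0 eqb0 negbK.
  by apply/imsetP; exists C; rewrite ?inE.
have [_ l0] := lift_point_neq0 fC tC.
rewrite (RP_triangulation_lift fC tC); apply/RP_of_eq => //.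
exists c => //; apply/rowP => k; rewrite !mxE big_set1 tE eqxx mul1r /= inE.
by case: eqP => [->|nc] /=; [ring | have [//|->] := xc k; ring].
Qed.

Theorem theorem3p24 (R : realType) (n : nat) (hn : (2 <= n)%N) :
  exists (p : nat) (X : {set {set 'I_p}}) (h : 'rV[R]_p -> RP R n),
    equilibrium_triangulation (@RP_act R n) (@std_simplex R n)
      (@RP_orbit_map R n) (simplex_center R n) X h
    /\ #|vertices X| = (2 ^ n + n + 1)%N.
Proof.
case: n hn => [//|n] _.
exists #|{: lifted_vertex n.+2}|, (flag_complex predT),
  (@RP_triangulation R n.+1).
split; last exact: card_vertices_flag_complex.
split; first exact: RP_triangulation_homeomorphism.
  exact: equilibrium_triangulated.
exists n.+2, (@RP_zone R n.+1); split; first exact: RP_zones_complete.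
exact: RP_zone_triangulated.
Qed.
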